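(* Let $q\in(1,\infty)$. Then the family $(S_j)_{j\in\mathbb N}$ forms a Schauder basis of the real Lebesgue space $L_q(0,1)$.
   Context: Let $S(t)=2t$ for $0\le t\le \frac12$ and $S(t)=2(1-t)$ for $\frac12<t\le 1$, and extend $S$ to $\mathbb R$ by $S(t)=(-1)^{\lfloor t\rfloor}S(t-\lfloor t\rfloor)$ (so $S$ is odd and $2$-periodic). For $j\in\mathbb N=\{1,2,\dots\}$ put $S_j(t)=S(jt)$, $t\in\mathbb R$, regarded as a function on $(0,1)$. A sequence $(\varphi_j)_{j=1}^\infty$ in a Banach space $X$ is a Schauder basis of $X$ if for every $x\in X$ there is a unique sequence of scalars $(\alpha_j)_{j=1}^\infty$ such that $x=\sum_{j=1}^\infty\alpha_j\varphi_j$ (norm convergence of the partial sums in the given order). *)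

(* Defs.v *)
From HB Require Import structures.
From mathcomp Require Import all_boot all_order all_algebra.
From mathcomp Require Import all_classical all_reals all_analysis.
From mathcomp Require Import measurable_realfun ess_sup_inf.
From mathcomp Require Import lra.

Set Implicit Arguments.
Unset Strict Implicit.
Unset Printing Implicit Defensive.

Import Order.TTheory GRing.Theory Num.Theory.
Import numFieldNormedType.Exports.

Local Open Scope classical_set_scope.
Local Open Scope ring_scope.

(** * The library type [LspaceType mu p1] of classes modulo almost everywhere
    equality comes without algebraic structure; it is made here into a normed
    space, the operations and the norm being those of representatives. *)

Section Lspace_normed.
Context d (T : measurableType d) (R : realType).
Variables (mu : {measure set T -> \bar R}) (p : \bar R) (p1 : (1 <= p)%E).

Local Notation Lf := (LfunType mu p1).
Local Notation Ls := (LspaceType mu p1).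

Lemma ae_eq_Lnorm (f g : T -> \bar R) :
  measurable_fun setT f -> measurable_fun setT g ->
  f = g %[ae mu] -> 'N[mu]_p[f]%E = 'N[mu]_p[g]%E.
Proof.
move=> mf mg fg; rewrite unlock /Lnorm; case: p p1 => [r _| _ |//].
  congr (_ `^ _)%E; apply: ae_eq_integral => //.
  - apply: (@measurableT_comp _ _ _ _ _ _ (fun x => x `^ r)%E) => //=.
      exact: (measurableT_comp (measurable_poweR _)).
    exact: measurableT_comp.
  - apply: (@measurableT_comp _ _ _ _ _ _ (fun x => x `^ r)%E) => //=.
      exact: (measurableT_comp (measurable_poweR _)).
    exact: measurableT_comp.
  - by apply: filterS fg => x /= /[apply] ->.
case: ifPn => // _; apply: eq_ess_sup.
by apply: filterS fg => x /= /(_ I) ->.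
Qed.

Lemma finite_norm_ae_eq (f g : T -> R) :
  measurable_fun setT f -> measurable_fun setT g ->
  f = g %[ae mu] -> finite_norm mu p f -> finite_norm mu p g.
Proof.
move=> mf mg fg; rewrite /finite_norm (@ae_eq_Lnorm _ (EFin \o g))//.
- exact/measurable_EFinP.
- exact/measurable_EFinP.
- by apply: filterS fg => x /= /[apply] ->.
Qed.

(* [measurableTypeR R] and [R] carry the same sigma-algebra under different
   displays. *)
Let mcodom_subproof (f : {mfun T >-> R}) :
  @isMeasurableFun d _ T (measurableTypeR R) f.
Proof. by split; exact: measurable_funPT f. Qed.
Let mcodom (f : {mfun T >-> R}) : {mfun T >-> measurableTypeR R} :=
  HB.pack (f : T -> measurableTypeR R) (mcodom_subproof f).

Let mclass (f : {mfun T >-> R}) : {mfun_ mu, T >-> measurableTypeR R} :=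
  (\pi_({mfun_ mu, T >-> measurableTypeR R}) (mcodom f))%qT.

Let pi_ae (f : {mfun T >-> R}) : (mclass f : T -> R) = f %[ae mu].
Proof.
have /eqmodP/asboolP : (repr (mclass f) = mcodom f
  %[mod {mfun_ mu, T >-> measurableTypeR R}])%qT by rewrite reprK.
exact.
Qed.

Let measurable_mcodom (f : {mfun T >-> measurableTypeR R}) :
  measurable_fun setT (f : T -> R).
Proof. by move=> mT A mA; exact: (@measurable_funPT _ _ _ _ f). Qed.

Let mfun_repr (u : Ls) : measurable_fun setT (u : T -> R).
Proof. exact: measurable_mcodom. Qed.

Let Lclass_subproof (f : Lf) : isFinLebesgue d T R mu p p1 (mclass f).
Proof.
split; apply: (@finite_norm_ae_eq f).
- exact: measurable_funPT.
- exact: measurable_mcodom.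
- exact/ae_eq_sym/pi_ae.
- exact: Lfunction_finite.
Qed.

Definition Lclass (f : Lf) : Ls := HB.pack (mclass f) (Lclass_subproof f).

Let Lrepr_subproof (u : Ls) : (u : T -> R) \in Lfun mu p.
Proof.
by apply/andP; split; rewrite inE/=; [exact: mfun_repr|exact: Lebesgue_finite].
Qed.

Definition Lrepr (u : Ls) : Lf := Lfun_Sub p1 (Lrepr_subproof u).

Lemma Lclass_ae (f : Lf) : (Lclass f : T -> R) = f %[ae mu].
Proof. exact: pi_ae. Qed.

Lemma LspaceP (u v : Ls) : (u : T -> R) = v %[ae mu] -> u = v.
Proof.
case: u => u [[uf]]; case: v => v [[vf]] /= uv.
have uvE : u = v by rewrite -[u]reprK -[v]reprK; apply/eqmodP/asboolP.
by case: _ / uvE vf {uv} => vf; rewrite (Prop_irrelevance uf vf).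
Qed.

Lemma LclassP (f g : Lf) : (f : T -> R) = g %[ae mu] -> Lclass f = Lclass g.
Proof.
move=> fg; apply: LspaceP; apply: ae_eq_trans (Lclass_ae f) _.
by apply: ae_eq_trans fg _; exact/ae_eq_sym/Lclass_ae.
Qed.

Lemma LreprK : cancel Lrepr Lclass.
Proof. by move=> u; apply: LspaceP; exact: Lclass_ae. Qed.

Lemma LclassK (f : Lf) : (Lrepr (Lclass f) : T -> R) = f %[ae mu].
Proof. exact: Lclass_ae. Qed.

HB.instance Definition _ := gen_eqMixin Ls.
HB.instance Definition _ := gen_choiceMixin Ls.

Let addL (u v : Ls) : Ls := Lclass (Lrepr u + Lrepr v).
Let oppL (u : Ls) : Ls := Lclass (- Lrepr u).
Let scaleL (a : R) (u : Ls) : Ls := Lclass (a *: Lrepr u).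

Let LfunD (f g : Lf) x : (f + g) x = f x + g x. Proof. by []. Qed.
Let LfunN (f : Lf) x : (- f) x = - f x. Proof. by []. Qed.
Let LfunZ a (f : Lf) x : (a *: f) x = a * f x. Proof. by []. Qed.

Let addL_class f g : addL (Lclass f) (Lclass g) = Lclass (f + g).
Proof.
apply: LclassP; apply: filterS2 (LclassK f) (LclassK g) => x fx gx _.
by rewrite !LfunD fx// gx.
Qed.

Let oppL_class f : oppL (Lclass f) = Lclass (- f).
Proof.
by apply: LclassP; apply: filterS (LclassK f) => x fx _; rewrite !LfunN fx.
Qed.

Let scaleL_class a f : scaleL a (Lclass f) = Lclass (a *: f).
Proof.
by apply: LclassP; apply: filterS (LclassK f) => x fx _; rewrite !LfunZ fx.
Qed.

Let addLA : associative addL.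
Proof.
move=> u v w; rewrite -[u]LreprK -[v]LreprK -[w]LreprK.
by rewrite !addL_class addrA.
Qed.

Let addLC : commutative addL.
Proof. by move=> u v; rewrite /addL addrC. Qed.

Let add0L : left_id (Lclass 0) addL.
Proof. by move=> u; rewrite -[u]LreprK addL_class add0r. Qed.

Let addNL : left_inverse (Lclass 0) oppL addL.
Proof. by move=> u; rewrite -[u]LreprK oppL_class addL_class addNr. Qed.

HB.instance Definition _ := GRing.isZmodule.Build Ls addLA addLC add0L addNL.

Let scaleLA a b u : scaleL a (scaleL b u) = scaleL (a * b) u.
Proof. by rewrite -[u]LreprK !scaleL_class scalerA. Qed.

Let scale1L : left_id 1 scaleL.
Proof. by move=> u; rewrite -[u]LreprK scaleL_class scale1r. Qed.

Let scaleLDr : right_distributive scaleL +%R.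
Proof.
move=> a u v; rewrite -[u]LreprK -[v]LreprK.
by rewrite [_ + _]addL_class !scaleL_class [RHS]addL_class scalerDr.
Qed.

Let scaleLDl u : {morph scaleL^~ u : a b / a + b}.
Proof.
move=> a b; rewrite -[u]LreprK !scaleL_class [RHS]addL_class.
by rewrite scalerDl.
Qed.

HB.instance Definition _ := GRing.Zmodule_isLmodule.Build R Ls
  scaleLA scale1L scaleLDr scaleLDl.

Definition Lspace_norm (u : Ls) : R := fine 'N[mu]_p[EFin \o u]%E.

Let normLclass (f : Lf) : Lspace_norm (Lclass f) = fine 'N[mu]_p[EFin \o f]%E.
Proof.
congr fine; apply: ae_eq_Lnorm; first exact/measurable_EFinP/mfun_repr.
  exact/measurable_EFinP/measurable_funPT.
by apply: filterS (Lclass_ae f) => x /= /[apply] ->.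
Qed.

Let normLD u v : Lspace_norm (u + v) <= Lspace_norm u + Lspace_norm v.
Proof.
rewrite -[u]LreprK -[v]LreprK [_ + _]addL_class !normLclass.
exact: ler_LnormD.
Qed.

Let normLZ a u : Lspace_norm (a *: u) = `|a| * Lspace_norm u.
Proof.
rewrite -[u]LreprK [_ *: _]scaleL_class !normLclass.
by apply: EFin_inj; rewrite EFinM !finite_norm_fine LnormZ.
Qed.

Let normL_eq0 u : Lspace_norm u = 0 -> u = 0.
Proof.
rewrite -[u]LreprK normLclass => /fine_Lnormr_eq0 u0.
exact: LclassP.
Qed.

HB.instance Definition _ := Lmodule_isNormed.Build R Ls normLD normLZ normL_eq0.

Lemma LclassD (f g : Lf) : Lclass (f + g) = Lclass f + Lclass g.
Proof. by rewrite [RHS]addL_class. Qed.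

Lemma LclassN (f : Lf) : Lclass (- f) = - Lclass f.
Proof. by rewrite [RHS]oppL_class. Qed.

Lemma LclassZ a (f : Lf) : Lclass (a *: f) = a *: Lclass f.
Proof. by rewrite [RHS]scaleL_class. Qed.

Lemma Lspace_normE (u : Ls) : `|u| = fine 'N[mu]_p[EFin \o u]%E.
Proof. by []. Qed.

Lemma norm_Lclass (f : Lf) : `|Lclass f| = fine 'N[mu]_p[EFin \o f]%E.
Proof. exact: normLclass. Qed.

End Lspace_normed.

Section schauder_basis.
Context (R : realType) (V : normedModType R).

(* The sequence is numbered from 0: [phi n] is the vector of index [n.+1] of
   a sequence numbered from 1.  Completeness of [V] plays no role in the
   definition. *)
Definition schauder_basis (phi : V^nat) :=
  forall x : V, exists! a : R^nat, series (fun n => a n *: phi n) @ \oo --> x.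

End schauder_basis.

Section L01.
Context (R : realType).

(* only meant for [0 <= t <= 1] *)
Definition tent (t : R) : R := if t <= 2^-1 then 2 * t else 2 * (1 - t).

Definition triwave (t : R) : R :=
  (-1) ^ Num.floor t * tent (t - (Num.floor t)%:~R).

Lemma measurable_triwave : measurable_fun setT triwave.
Proof.
have mtent : measurable_fun setT tent.
  apply: measurable_fun_ifT.
  - exact: measurable_fun_ler.
  - exact: measurable_funM.
  - by apply: measurable_funM => //; exact: measurable_funB.
move=> _ A mA; rewrite setTI.
pose F (n : int) : set R := `[n%:~R, (n + 1)%:~R[%classic `&`
  ((fun t : R => (-1) ^ n * tent (t - n%:~R)) @^-1` A).
have -> : triwave @^-1` A = \bigcup_n F n.
  apply/seteqP; split => [t At|t [n _ []]].
    exists (Num.floor t) => //; split => //=.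
    by rewrite in_itv/= floor_itv.
  by rewrite /= in_itv/= => /floor_def <-.
apply: countable_bigcupT_measurable => // n; apply: measurableI => //.
rewrite -[X in measurable X]setTI.
suff : measurable_fun setT (fun t : R => (-1) ^ n * tent (t - n%:~R)) by exact.
apply: measurable_funM => //; apply: (measurableT_comp mtent).
exact: measurable_funB.
Qed.

Lemma normr_triwave_le1 (t : R) : `|triwave t| <= 1.
Proof.
rewrite normrM (_ : `|_ ^ _| = 1) ?mul1r; last first.
  by case: (Num.floor t) => k; rewrite /exprz ?normfV normrX normrN1 expr1n ?invr1.
have /andP[] := floor_itv t; rewrite intrD -subr_ge0 -ltrBlDl.
set u := t - _ => u0 u1; rewrite /tent ler_norml; case: ifPn; lra.
Qed.

Lemma measurable_oo01 :
  measurable (`]0, 1[%classic : set (measurableTypeR R)).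
Proof. exact: measurable_itv. Qed.

Lemma lebesgue_measure01_lty :
  (lebesgue_measure (`]0%R, 1%R[%classic : set (measurableTypeR R)) < +oo)%E.
Proof. by rewrite lebesgue_measure_itv/= lte_fin ltr01 -EFinD ltry. Qed.

(* Lebesgue measure on (0,1), seen as a measure on [R] vanishing outside (0,1) *)
Definition leb01 : {finite_measure set (measurableTypeR R) -> \bar R} :=
  mfrestr measurable_oo01 lebesgue_measure01_lty.

Variables (q : R) (q1 : 1 < q).

Lemma Lexponent_ge1 : (1 <= q%:E)%E. Proof. by rewrite lee_fin ltW. Qed.

Definition L01 := LspaceType leb01 Lexponent_ge1.
HB.instance Definition _ := NormedModule.on L01.

Lemma Lfun_triwave (j : nat) :
  (fun t : measurableTypeR R => triwave (j%:R * t)) \in Lfun leb01 q%:E.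
Proof.
have mS : measurable_fun setT
    ((fun t => triwave (j%:R * t)) : measurableTypeR R -> R).
  apply: (measurableT_comp measurable_triwave).
  exact: (@measurable_funM _ (measurableTypeR R)).
apply: (@Lfun_subset _ _ _ leb01 q%:E +oo%E) => //.
- exact: Lexponent_ge1.
- exact: leey.
- exact: fin_num_measure.
- exact: leey.
apply/andP; split; rewrite inE//= /finite_norm unlock /Lnorm.
case: ifPn => _; last exact: ltry.
apply: (@le_lt_trans _ _ 1%E); last exact: ltry.
by apply/ess_supP/nearW => t /=; rewrite lee_fin normr_triwave_le1.
Qed.

Definition dilated_triwave (j : nat) : L01 :=
  Lclass (Lfun_Sub Lexponent_ge1 (Lfun_triwave j)).

End L01.

(* Main.v *)
(** Let e_n(t) = sin (n pi t).  The Fourier series of S has sine coefficients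
    c_j with c_1 > 0 and |c_j| <= c_1 / j^2, and S_n = sum_j c_j e_(jn).  Since
    the dilation t -> kt preserves the L_q norm of odd 2-periodic functions, and
    sum_(j >= 2) 1/j^2 <= 3/4, one gets
      |sum a_n S_n - c_1 sum a_n e_n| <= 3/4 c_1 |sum a_n e_n|
    for every finite sum.  Hence (S_n) inherits from (e_n) both totality and the
    Grunblum inequality |sum_(n < m) a_n e_n| <= K |sum_(n < N) a_n e_n|, m <= N,
    which together characterize Schauder bases.

    The Grunblum inequality for (e_n) is M. Riesz's theorem: modulating by the
    frequency (m + 1/2) pi, conjugating and demodulating truncates a sine sum
    after m terms.  Let u + iv be the holomorphic extension of a trigonometric
    sum with positive frequencies to the half-cylinder t <= 0, where it decays at
    -oo.  With s = min (1, q/2), w = q/2 - s and a suitable B, the function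
      B (u^2 + e)^s (u^2 + v^2 + e)^w - (u^2 + v^2 + e)^(q/2)
    is subharmonic, so its integral over the circles t = const is convex and
    bounded in t, hence nondecreasing; comparing t = 0 with t -> -oo and letting
    e -> 0 bounds |v|_q by |u|_q.

    Totality: the sine series of the Green functions min (s, t) - s t converge
    uniformly, and difference quotients in s of Green functions converge in L_q
    to 1 - t minus the indicator of (0, s]. *)
Require Import Defs.
From mathcomp Require Import all_boot all_order all_algebra.
From mathcomp Require Import all_classical all_reals all_analysis.
From mathcomp Require Import measurable_realfun lra ring.
Set Implicit Arguments.
Unset Strict Implicit.
Unset Printing Implicit Defensive.

Import Order.TTheory GRing.Theory Num.Theory.
Import numFieldNormedType.Exports.
Local Open Scope classical_set_scope.
Local Open Scope ring_scope.

(** * Subharmonic functions on a cylinder *)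

Section periodic_submean.
Context (R : realType).
Local Notation mu := (@lebesgue_measure R).

(** Why s = min (1, q/2): with F = u + iv, the Laplacian of (u^2 + e)^s is at least 2s(2s-1) (u^2 +
    e)^(s-1) |F'|^2, and 2s > 1 because q > 1. It has to beat the Laplacian of (u^2 + v^2 +
    e)^(q/2), which is of order (u^2 + v^2 + e)^(q/2-1) |F'|^2. Since u^2 <= u^2 + v^2, the
    comparison uses s - 1 <= 0; for q > 2 the factor of exponent w restores the homogeneity. The
    mixed product is then split by a Young inequality, whose part in u^2 + v^2 is absorbed on the
    left. The parameter e keeps the powers smooth at the zeros.

    The half-integer m + 1/2 keeps the shifted frequencies away from 0, which gives the decay at
    -oo.

    In the perturbation, what counts is 3/4 < 1: equal coefficients give sums of comparable norms,
    and each e_n is recovered from the S_j by an iteration of ratio 7/8 = 3/4 + 1/8, the 1/8 paying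
    for the truncation of the series. *)

Lemma continuous_integrable_itv (f : R -> R) (a b : R) :
  continuous f -> mu.-integrable `[a, b] (EFin \o f).
Proof.
move=> cf; apply: continuous_compact_integrable; first exact: segment_compact.
exact: continuous_subspaceT.
Qed.

Lemma continuous2_curry (f : R -> R -> R) (t : R) :
  continuous (fun z : R * R => f z.1 z.2) -> continuous (f t).
Proof.
move=> cf x; apply: (@continuous_comp _ _ _ (fun y : R => (t, y)) (fun z : R * R => f z.1 z.2)).
  exact: (@cvg_pair R R R (nbhs x) (nbhs t) (nbhs x) _ _ _ (cst t) id (cvg_cst t) cvg_id).
exact: cf.
Qed.

Lemma continuous2_bounded (f : R -> R -> R) (a b c d : R) :
  continuous (fun z : R * R => f z.1 z.2) ->
  exists2 M : R, 0 <= M & forall t x, t \in `[a, b] -> x \in `[c, d] -> `|f t x| <= M.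
Proof.
move=> cf.
have cp : compact (`[a, b] `*` `[c, d] : set (R * R)).
  by apply: compact_setX; exact: segment_compact.
have cfW : {within `[a, b] `*` `[c, d], continuous (fun z : R * R => f z.1 z.2)}.
  exact: continuous_subspaceT.
have [M [_ HM]] := compact_bounded (continuous_compact cfW cp).
exists (`|M| + 1); first by rewrite addr_ge0.
move=> t x ht hx; apply: (HM (`|M| + 1)).
  by rewrite (le_lt_trans (ler_norm M))// ltrDl.
by exists (t, x).
Qed.

Lemma is_derive_under_Rintegral (T : R) (f df : R -> R -> R) :
  (forall t x : R, is_derive t (1 : R) (f^~ x) (df t x)) ->
  continuous (fun z : R * R => f z.1 z.2) ->
  continuous (fun z : R * R => df z.1 z.2) ->
  forall t : R, is_derive t (1 : R) (fun t => \int[mu]_(x in `[0, T]) f t x)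
                          (\int[mu]_(x in `[0, T]) df t x).
Proof.
move=> fdf cf cdf t.
have d1E s x : partial1of2 f s x = df s x.
  by rewrite partial1of2E; exact: derive_val.
(* A bound of [df] on a compact box around [t] is a constant, hence an integrable dominating
   function. *)
have [M M0 HM] := continuous2_bounded (t - 1) (t + 1) 0 T cdf.
have It : `]t - 1, t + 1[%classic t by rewrite /= in_itv/=; lra.
have intf s : mu.-integrable `[0, T] (EFin \o f s).
  by apply: continuous_integrable_itv; exact: continuous2_curry.
have intM : mu.-integrable `[0, T] (EFin \o cst M).
  by apply: continuous_integrable_itv; exact: cst_continuous.
have derf s x : derivable (f^~ x) s 1 by exact: ex_derive.
have HM' s x : `]t - 1, t + 1[%classic s -> `[0, T]%classic x -> `|partial1of2 f s x| <= M.
  by move=> hs hx; rewrite d1E; apply: HM => //; apply: subset_itv_oo_cc.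
have mT : measurable (`[0, T] : set (measurableTypeR R)) by exact: measurable_itv.
split.
  exact: (@derivable_under_integral _ _ _ mu f _ mT t _ _ It
    (fun s _ => intf s) (fun s x _ _ => derf s x) _ (fun=> M0) intM HM').
rewrite -derive1E (@differentiation_under_integral _ _ _ mu f _ mT t _ _ It
    (fun s _ => intf s) (fun s x _ _ => derf s x) _ (fun=> M0) intM HM').
by apply: eq_Rintegral => x _; rewrite d1E.
Qed.

Lemma Rintegral_derive (T : R) (f df : R -> R) : 0 < T ->
  (forall x : R, is_derive x (1 : R) f (df x)) -> continuous df ->
  \int[mu]_(x in `[0, T]) df x = f T - f 0.
Proof.
move=> T0 fdf cdf; rewrite /Rintegral (@continuous_FTC2 _ df f)//.
- exact: continuous_subspaceT.
- have cf : continuous f.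
    by move=> x; apply: differentiable_continuous; apply/derivable1_diffP; exact: ex_derive.
  split.
  + by move=> x _; exact: ex_derive.
  + exact: cvg_at_right_filter (cf _).
  + exact: cvg_at_left_filter (cf _).
- by move=> x _; rewrite derive1E; exact: derive_val.
Qed.

Lemma derive_ge0_nondecreasing (f df : R -> R) :
  (forall x : R, is_derive x (1 : R) f (df x)) -> (forall x : R, 0 <= df x) ->
  {homo f : x y / x <= y}.
Proof.
move=> fdf df0 x y xy.
have cf : continuous f.
  by move=> z; apply: differentiable_continuous; apply/derivable1_diffP; exact: ex_derive.
apply: (@ger0_derive1_le_cc _ f x y) => //.
- by move=> z _; rewrite derive1E derive_val.
- exact: continuous_subspaceT.
- by rewrite in_itv/= lexx xy.
- by rewrite in_itv/= lexx xy.
Qed.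

(** A negative slope at some [t0 <= 0] would, by convexity, keep the graph above a line that grows
    without bound towards -oo, against the bound [C]. Hence all slopes on [t <= 0] are
    nonnegative. *)
Lemma bounded_convex_nondecreasing (m dm ddm : R -> R) (C : R) :
  (forall t : R, is_derive t (1 : R) m (dm t)) -> (forall t : R, is_derive t (1 : R) dm (ddm t)) ->
  (forall t : R, 0 <= ddm t) -> (forall t : R, t <= 0 -> m t <= C) ->
  forall t, t <= 0 -> m t <= m 0.
Proof.
move=> m1 m2 m20 mC.
have dmle := @derive_ge0_nondecreasing _ _ m2 m20.
have cm : continuous m.
  by move=> z; apply: differentiable_continuous; apply/derivable1_diffP; exact: ex_derive.
have tangent t0 t : t < t0 -> m t0 - m t <= dm t0 * (t0 - t).
  move=> tt0; have [|c] := MVT tt0 (fun x _ => m1 x).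
    exact: continuous_subspaceT.
  rewrite in_itv/= => /andP[_ /ltW ct ->]; rewrite ler_wpM2r ?subr_ge0 ?(ltW tt0)//.
  exact: dmle.
have dm0 t0 : t0 <= 0 -> 0 <= dm t0.
  move=> t00; rewrite leNgt; apply/negP => dmt0.
  (* So far to the left, the tangent line at [t0] has risen above [C]; the extra 1 makes this
     strict. *)
  pose t := t0 - 1 - `|(m t0 - C) / dm t0|.
  have tt0 : t < t0 by rewrite /t; have := normr_ge0 ((m t0 - C) / dm t0); lra.
  have := tangent t0 t tt0; have := mC t (le_trans (ltW tt0) t00).
  have -> : t0 - t = 1 + `|(m t0 - C) / dm t0| by rewrite /t; ring.
  rewrite mulrDr mulr1 normrM normfV [`|dm t0|]ltr0_norm// invrN mulrN mulrN mulrCA.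
  rewrite divff ?lt_eqF// mulr1.
  have := ler_norm (m t0 - C); have := ler_norm (- (m t0 - C)); rewrite normrN; lra.
move=> t; rewrite le_eqVlt => /orP[/eqP->//|t0].
have [|c] := MVT t0 (fun x _ => m1 x); first exact: continuous_subspaceT.
rewrite in_itv/= => /andP[_ /ltW c0] h.
by rewrite -subr_ge0 h mulr_ge0 ?dm0// subr_ge0 ltW.
Qed.

(** Meant for [g] the angular derivative of [f], so that [f2 + g2] is the Laplacian. Over a period
    [g2] integrates to [g t T - g t 0 = 0]; the second derivative of the integral of [f] is
    therefore the integral of the Laplacian. *)
Lemma cylinder_submean (T : R) (f f1 f2 g g2 : R -> R -> R) (C : R) : 0 < T ->
  (forall t x : R, is_derive t (1 : R) (f^~ x) (f1 t x)) ->
  (forall t x : R, is_derive t (1 : R) (f1^~ x) (f2 t x)) ->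
  (forall t x : R, is_derive x (1 : R) (g t) (g2 t x)) ->
  continuous (fun z : R * R => f z.1 z.2) ->
  continuous (fun z : R * R => f1 z.1 z.2) ->
  continuous (fun z : R * R => f2 z.1 z.2) ->
  continuous (fun z : R * R => g2 z.1 z.2) ->
  (forall t x : R, 0 <= f2 t x + g2 t x) ->
  (forall t : R, g t T = g t 0) ->
  (forall t x : R, t <= 0 -> f t x <= C) ->
  forall t, t <= 0 ->
  \int[mu]_(x in `[0, T]) f t x <= \int[mu]_(x in `[0, T]) f 0 x.
Proof.
move=> T0 ff1 f12 gg2 cf cf1 cf2 cg2 fg0 gT fC.
have int (h : R -> R -> R) t : continuous (fun z : R * R => h z.1 z.2) ->
    mu.-integrable `[0, T] (EFin \o h t).
  by move=> ch; apply: continuous_integrable_itv; exact: continuous2_curry.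
apply: (@bounded_convex_nondecreasing (fun t => \int[mu]_(x in `[0, T]) f t x)
  (fun t => \int[mu]_(x in `[0, T]) f1 t x) (fun t => \int[mu]_(x in `[0, T]) f2 t x)
  (\int[mu]_(x in `[0, T]) C)).
- exact: is_derive_under_Rintegral.
- exact: is_derive_under_Rintegral.
- move=> t; have : \int[mu]_(x in `[0, T]) g2 t x = 0.
    rewrite (@Rintegral_derive _ (g t))// ?gT ?subrr//.
    exact: continuous2_curry.
  move=> g20.
  have -> : \int[mu]_(x in `[0, T]) f2 t x = \int[mu]_(x in `[0, T]) (f2 t x + g2 t x).
    by rewrite RintegralD ?g20 ?addr0//; exact: int.
  exact: Rintegral_ge0.
- move=> t t0; apply: le_Rintegral => //; first exact: int.
    by apply: continuous_integrable_itv; exact: cst_continuous.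
  by move=> x _; exact: fC.
Qed.

End periodic_submean.

(** * Differentiation rules for functions written pointwise *)

Section pointwise_calculus.
Context (R : realType).
Implicit Types (f g : R -> R) (t df dg : R).

Lemma is_deriveD_fun f g t df dg : is_derive t (1 : R) f df ->
  is_derive t (1 : R) g dg -> is_derive t (1 : R) (fun x => f x + g x) (df + dg).
Proof. exact: is_deriveD. Qed.

Lemma is_deriveN_fun f t df : is_derive t (1 : R) f df ->
  is_derive t (1 : R) (fun x => - f x) (- df).
Proof. exact: is_deriveN. Qed.

Lemma is_deriveM_fun f g t df dg : is_derive t (1 : R) f df ->
  is_derive t (1 : R) g dg -> is_derive t (1 : R) (fun x => f x * g x) (df * g t + f t * dg).
Proof.
move=> hf hg; apply: (is_derive_eq (is_deriveM hf hg)).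
by rewrite /GRing.scale/= addrC mulrC.
Qed.

Lemma is_deriveX2_fun f t df : is_derive t (1 : R) f df ->
  is_derive t (1 : R) (fun x => f x ^+ 2) (2 * f t * df).
Proof. by move=> hf; apply: (is_derive_eq (is_deriveX 2 hf)); rewrite expr1. Qed.

Lemma is_deriveV_fun f t df : f t != 0 -> is_derive t (1 : R) f df ->
  is_derive t (1 : R) (fun x => (f x)^-1) (- df * (f t)^-1 ^+ 2).
Proof.
move=> f0 hf; apply: (is_derive_eq (is_deriveV f0 hf)).
by rewrite /GRing.scale/= exprVn mulNr mulNr mulrC.
Qed.

Lemma is_derive_powR_fun f t df p : 0 < f t -> is_derive t (1 : R) f df ->
  is_derive t (1 : R) (fun x => f x `^ p) (f t `^ p * (p * df / f t)).
Proof.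
move=> f0 hf; apply: (is_derive_eq (is_derive1_comp (is_derive1_powR p f0) hf)).
rewrite powRB ?(gt_eqF f0) ?implybT// powRr1 ?ltW//; ring.
Qed.

Lemma is_derive_cst_fun (c : R) t : is_derive t (1 : R) (fun=> c) 0.
Proof. exact: is_derive_cst. Qed.

Lemma is_derive_id_fun t : is_derive t (1 : R) (fun x => x) 1.
Proof. exact: is_derive_id. Qed.

Lemma is_derive_sum_fun (I : Type) (r : seq I) (h : I -> R -> R) (dh : I -> R) t :
  (forall i, is_derive t (1 : R) (h i) (dh i)) ->
  is_derive t (1 : R) (fun x => \sum_(i <- r) h i x) (\sum_(i <- r) dh i).
Proof.
move=> hd; elim: r => [|i r IH].
  rewrite big_nil (_ : (fun _ => _) = (fun=> 0)); first exact: is_derive_cst.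
  by apply/funext => x; rewrite big_nil.
rewrite big_cons (_ : (fun _ => _) = (fun x => h i x + \sum_(j <- r) h j x)).
  exact: is_deriveD_fun.
by apply/funext => x; rewrite big_cons.
Qed.

Lemma is_derive_scale (f df : R -> R) (c x : R) : (forall y : R, is_derive y (1 : R) f (df y)) ->
  is_derive x (1 : R) (fun y => f (c * y)) (df (c * x) * c).
Proof.
move=> fdf; apply: (@is_derive1_comp _ f (fun y => c * y)).
by apply: (is_derive_eq (is_deriveM_fun (is_derive_cst_fun c x) (is_derive_id_fun x))); ring.
Qed.

End pointwise_calculus.

(* The side conditions of the quotient and power rules are left to the caller. *)
Ltac derive_fun :=
  repeat (first [ eassumption | eapply is_derive_cst_fun | eapply is_derive_id_fun
    | eapply is_deriveD_fun | eapply is_deriveN_fun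
    | eapply is_deriveX2_fun | eapply is_deriveM_fun
    | eapply is_deriveV_fun; [| ] | eapply is_derive_powR_fun; [| ] ]).

(** * The subharmonic function behind the estimate of M. Riesz *)

Section subharmonic.
Context (R : realType).
Variables (a s w e B : R).
Hypothesis e0 : 0 < e.

Local Notation sq x := (x ^+ 2 + e).
Local Notation sq2 x y := (x ^+ 2 + y ^+ 2 + e).

Definition sph (x y : R) := B * (sq x `^ s * sq2 x y `^ w) - sq2 x y `^ a.

(** First derivative of [sph] along a curve with velocity [(p, q)]; [sph2] is the second one, with
    acceleration [(p', q')]. Each product of powers is kept as a factor times its logarithmic
    derivative, so that [field] can treat the powers as opaque. *)
Definition sph1 (x y p q : R) :=
  B * (sq x `^ s * sq2 x y `^ w) *
    (s * (2 * x * p) * (sq x)^-1 + w * (2 * x * p + 2 * y * q) * (sq2 x y)^-1)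
  - sq2 x y `^ a * (a * (2 * x * p + 2 * y * q) * (sq2 x y)^-1).

Definition sph2 (x y p q p' q' : R) :=
  let E := 2 * x * p + 2 * y * q in
  let E' := 2 * p ^+ 2 + 2 * x * p' + 2 * q ^+ 2 + 2 * y * q' in
  B * (sq x `^ s * sq2 x y `^ w) *
    ((s * (2 * x * p) * (sq x)^-1 + w * E * (sq2 x y)^-1) ^+ 2
     + s * ((2 * p ^+ 2 + 2 * x * p') * (sq x)^-1 - (2 * x * p) ^+ 2 * (sq x)^-1 ^+ 2)
     + w * (E' * (sq2 x y)^-1 - E ^+ 2 * (sq2 x y)^-1 ^+ 2))
  - sq2 x y `^ a * ((a * E * (sq2 x y)^-1) ^+ 2
     + a * (E' * (sq2 x y)^-1 - E ^+ 2 * (sq2 x y)^-1 ^+ 2)).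

Lemma sq_gt0 (x : R) : 0 < sq x.
Proof. by rewrite ltr_wpDl// sqr_ge0. Qed.

Lemma sq2_gt0 (x y : R) : 0 < sq2 x y.
Proof. by rewrite ltr_wpDl// addr_ge0// sqr_ge0. Qed.

Lemma is_derive_sph (x y : R -> R) (t p q : R) :
  is_derive t (1 : R) x p -> is_derive t (1 : R) y q ->
  is_derive t (1 : R) (fun t => sph (x t) (y t)) (sph1 (x t) (y t) p q).
Proof.
move=> hx hy; rewrite /sph /sph1.
have hX := sq_gt0 (x t); have hP := sq2_gt0 (x t) (y t).
eapply is_derive_eq; first by derive_fun.
by rewrite /=; move: (_ `^ s) (_ `^ w) (_ `^ a) => ? ? ?; field; rewrite !gt_eqF.
Qed.

Lemma is_derive_sph1 (x y p q : R -> R) (t p' q' : R) :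
  is_derive t (1 : R) x (p t) -> is_derive t (1 : R) y (q t) ->
  is_derive t (1 : R) p p' -> is_derive t (1 : R) q q' ->
  is_derive t (1 : R) (fun t => sph1 (x t) (y t) (p t) (q t))
    (sph2 (x t) (y t) (p t) (q t) p' q').
Proof.
move=> hx hy hp hq; rewrite /sph1 /sph2.
have hX := sq_gt0 (x t); have hP := sq2_gt0 (x t) (y t).
eapply is_derive_eq; first by derive_fun => //; rewrite gt_eqF.
by rewrite /=; move: (_ `^ s) (_ `^ w) (_ `^ a) => ? ? ?; field; rewrite !gt_eqF.
Qed.

(* [(p, q)] and [(- q, p)] are the derivatives of a holomorphic map along two
   orthogonal directions, so that the left-hand side is a Laplacian. *)
Lemma sph_subharmonic (x y p q p' q' : R) :
  s <= 1 -> 1 < 2 * s -> 0 <= w -> a = s + w ->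
  B * (2 * s * (2 * s - 1)) = 4 * a * (a + 1) ->
  0 <= sph2 x y p q p' q' + sph2 x y (- q) p (- p') (- q').
Proof.
move=> s1 s2 w0 aE BE; have hX := sq_gt0 x; have hP := sq2_gt0 x y.
have s0 : 0 < s by lra.
have a0 : 0 < a by rewrite aE ltr_wpDr.
have B0 : 0 <= B.
  have k0 : 0 < 2 * s * (2 * s - 1) by rewrite mulr_gt0//; lra.
  by rewrite -(pmulr_lge0 _ k0) BE mulr_ge0//; lra.
(* Since [s <= 1], the power z^(s-1) is nonincreasing, and [sq x <= sq2 x y]. *)
have XP : sq x `^ s * sq2 x y `^ w * (sq x)^-1 >= sq2 x y `^ a * (sq2 x y)^-1.
  have XPs : sq x `^ (1 - s) <= sq2 x y `^ (1 - s).
    by rewrite ge0_ler_powR ?nnegrE ?subr_ge0 ?(ltW hX) ?(ltW hP)// lerD2r lerDl sqr_ge0.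
  have powV z : 0 < z -> z `^ s * z^-1 = (z `^ (1 - s))^-1.
    move=> z0; rewrite -powRN opprB powRB ?powRr1 ?(ltW z0)//.
    by rewrite (gt_eqF z0) implybT.
  rewrite aE powRD ?(gt_eqF hP) ?implybT// mulrAC powV// [leRHS]mulrAC powV//.
  by rewrite ler_wpM2r ?powR_ge0// lef_pV2// posrE powR_gt0.
set X := (sq x)^-1 in XP *; set P := (sq2 x y)^-1 in XP *.
have XE : X * sq x = 1 by rewrite mulVf// gt_eqF.
have PE : P * sq2 x y = 1 by rewrite mulVf// gt_eqF.
have X0 : 0 < X by rewrite invr_gt0.
have P0 : 0 < P by rewrite invr_gt0.
rewrite /sph2 /= -/X -/P.
have M0 : 0 <= sq x `^ s * sq2 x y `^ w by rewrite mulr_ge0// powR_ge0.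
have A0 : 0 <= sq2 x y `^ a by rewrite powR_ge0.
move: (sq x `^ s * sq2 x y `^ w) (sq2 x y `^ a) M0 A0 XP => M A M0 A0 XP.
set lhs := (X in 0 <= X).
(* Adding the two orthogonal directions cancels [p'] and [q'] and leaves the factor |F'|^2 = p^2 +
   q^2. In the bracket only the term in 4a(a+1) has the wrong sign; the term in 2s(2s-1) is there to
   outweigh it. *)
have -> : lhs = (p ^+ 2 + q ^+ 2) *
  (B * M * (2 * s * (2 * s - 1) * X + 4 * s * (1 - s) * X * (1 - X * x ^+ 2)
    + 8 * s * w * x ^+ 2 * X * P + 4 * w ^+ 2 * (x ^+ 2 + y ^+ 2) * P ^+ 2
    + 4 * w * P * (1 - P * (x ^+ 2 + y ^+ 2)))
   - A * (4 * a * (a + 1) * P - 4 * a ^+ 2 * P * (1 - P * (x ^+ 2 + y ^+ 2))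
     - 4 * a * P ^+ 2 * (x ^+ 2 + y ^+ 2))).
  by rewrite /lhs; ring.
have Xx : 0 <= 1 - X * x ^+ 2.
  by rewrite -XE mulrDr [_ + X * e]addrC addrK mulr_ge0// ltW.
have Pr : 0 <= 1 - P * (x ^+ 2 + y ^+ 2).
  by rewrite -PE mulrDr [_ + P * e]addrC addrK mulr_ge0// ltW.
have r0 : 0 <= x ^+ 2 + y ^+ 2 by rewrite addr_ge0// sqr_ge0.
apply: mulr_ge0; first by rewrite addr_ge0// sqr_ge0.
have s1' : 0 <= 1 - s by rewrite subr_ge0.
clear lhs.
(* [BE] equates the two coefficients, which reduces the claim to [XP]. *)
have main : A * (4 * a * (a + 1) * P) <= B * M * (2 * s * (2 * s - 1) * X).
  rewrite [leRHS](_ : _ = 4 * a * (a + 1) * (M * X)); last by rewrite -BE; ring.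
  by rewrite mulrCA ler_wpM2l// !mulr_ge0//; lra.
have n1 : 0 <= B * M * (4 * s * (1 - s) * X * (1 - X * x ^+ 2)
    + 8 * s * w * x ^+ 2 * X * P + 4 * w ^+ 2 * (x ^+ 2 + y ^+ 2) * P ^+ 2
    + 4 * w * P * (1 - P * (x ^+ 2 + y ^+ 2))).
  by repeat (first [exact: ler0n | assumption | exact: sqr_ge0 | exact: ltW | apply: addr_ge0 | apply: mulr_ge0]).
have n2 : 0 <= A * (4 * a ^+ 2 * P * (1 - P * (x ^+ 2 + y ^+ 2))
     + 4 * a * P ^+ 2 * (x ^+ 2 + y ^+ 2)).
  by repeat (first [exact: ler0n | assumption | exact: sqr_ge0 | exact: ltW | apply: addr_ge0 | apply: mulr_ge0]).
rewrite -subr_ge0 in main.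
apply: (le_trans (addr_ge0 (addr_ge0 main n1) n2)).
by rewrite le_eqVlt; apply/orP; left; apply/eqP; ring.
Qed.

End subharmonic.

(* [continuous f] is notation for a product; a head symbol is needed to match on. *)
Definition contf (R : realType) (T : topologicalType) (f : T -> R) := continuous f.

Section continuity_combinators.
Context (R : realType) (T : topologicalType).
Implicit Types f g : T -> R.

Lemma contfD f g : contf f -> contf g -> contf (fun x => f x + g x).
Proof. by move=> cf cg x; apply: cvgD; [exact: cf|exact: cg]. Qed.

Lemma contfN f : contf f -> contf (fun x => - f x).
Proof. by move=> cf x; apply: cvgN; exact: cf. Qed.

Lemma contfM f g : contf f -> contf g -> contf (fun x => f x * g x).
Proof. by move=> cf cg x; apply: cvgM; [exact: cf|exact: cg]. Qed.

Lemma contfX2 f : contf f -> contf (fun x => f x ^+ 2).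
Proof. by move=> cf; exact: contfM. Qed.

Lemma contfV f : (forall x, 0 < f x) -> contf f -> contf (fun x => (f x)^-1).
Proof. by move=> f0 cf x; apply: cvgV; [rewrite gt_eqF|exact: cf]. Qed.

Lemma contf_cst (c : R) : contf (fun _ : T => c).
Proof. by move=> x; exact: cvg_cst. Qed.

Lemma contf_comp (h : R -> R) f : continuous h -> contf f -> contf (fun x => h (f x)).
Proof. by move=> ch cf x; apply: (@continuous_comp _ _ _ f h); [exact: cf|exact: ch]. Qed.

Lemma contf_powR f p : (forall x, 0 < f x) -> contf f -> contf (fun x => f x `^ p).
Proof.
move=> f0 cf x; apply: (@continuous_comp _ _ _ f (fun y : R => y `^ p)); first exact: cf.
apply: differentiable_continuous; apply/derivable1_diffP.
by apply: ex_derive; exact: is_derive1_powR.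
Qed.

Lemma contf_norm_powR f (p : R) : 0 < p ->
  contf f -> contf (fun x => `|f x| `^ p).
Proof.
move=> p0 cf; apply: (@contf_comp (fun y => `|y| `^ p)) => //.
move=> y; have [->|y0] := eqVneq y 0.
  apply/cvgrPdist_lt => e e0; rewrite normr0 powR0 ?gt_eqF//.
  near=> z; rewrite sub0r normrN ger0_norm ?powR_ge0//.
  have : `|z| < e `^ p^-1.
    near: z; apply: cvgr0_norm_lt; first exact: cvg_id.
    exact: powR_gt0.
  move=> /(gt0_ltr_powR p0); rewrite -powRrM mulVf ?gt_eqF// powRr1 ?(ltW e0)//.
  by apply; rewrite nnegrE// powR_ge0.
apply: (@continuous_comp _ _ _ (fun y : R => `|y|) (fun y : R => y `^ p)).
  exact: norm_continuous.
apply: differentiable_continuous; apply/derivable1_diffP.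
by apply: ex_derive; apply: is_derive1_powR; rewrite normr_gt0.
Unshelve. all: by end_near.
Qed.

Lemma contf_sum (I : Type) (r : seq I) (h : I -> T -> R) :
  (forall i, contf (h i)) -> contf (fun x => \sum_(i <- r) h i x).
Proof.
move=> ch; elim: r => [|i r IH].
  rewrite (_ : (fun _ => _) = (fun=> 0)); first exact: contf_cst.
  by apply/funext => x; rewrite big_nil.
rewrite (_ : (fun _ => _) = (fun x => h i x + \sum_(j <- r) h j x)).
  exact: contfD.
by apply/funext => x; rewrite big_cons.
Qed.

End continuity_combinators.

Lemma contf_id (R : realType) : contf (fun x : R => x).
Proof. by move=> x; exact: cvg_id. Qed.

Ltac continuity :=
  lazymatch goal with
  | |- contf (fun _ => ?c) => exact: contf_cst
  | |- contf (fun z => z) => exact: contf_id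
  | |- contf (fun z => @?f z + @?g z) => apply: (@contfD _ _ f g); continuity
  | |- contf (fun z => @?f z * @?g z) => apply: (@contfM _ _ f g); continuity
  | |- contf (fun z => - @?f z) => apply: (@contfN _ _ f); continuity
  | |- contf (fun z => @?f z ^+ 2) => apply: (@contfX2 _ _ f); continuity
  | |- contf (fun z => (@?f z)^-1) => apply: (@contfV _ _ f); [| continuity]
  | |- contf (fun z => `|@?f z| `^ ?p) => apply: (@contf_norm_powR _ _ f p); [| continuity]
  | |- contf (fun z => @?f z `^ ?p) => apply: (@contf_powR _ _ f p); [| continuity]
  | |- contf (fun z => expR (@?f z)) =>
      apply: (@contf_comp _ _ _ f (@continuous_expR _)); continuity
  | |- contf (fun z => sin (@?f z)) =>
      apply: (@contf_comp _ _ _ f (@continuous_sin _)); continuity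
  | |- contf (fun z => cos (@?f z)) =>
      apply: (@contf_comp _ _ _ f (@continuous_cos _)); continuity
  | |- contf _ => try assumption
  end.

(** * Holomorphic extensions of trigonometric sums *)

Section trigonometric_sums.
Context (R : realType) (I : finType).
Variables (lam al be : I -> R).

(* Real and imaginary parts of [sum_i lam_i^k (al_i - i be_i) exp (lam_i (t + i x))]:
   each [t]-derivative raises [k] by one. *)
Definition tre (k : nat) (t x : R) : R :=
  \sum_i lam i ^+ k * expR (lam i * t) * (al i * cos (lam i * x) + be i * sin (lam i * x)).
Definition tim (k : nat) (t x : R) : R :=
  \sum_i lam i ^+ k * expR (lam i * t) * (al i * sin (lam i * x) - be i * cos (lam i * x)).

Let is_derive_exp (c x : R) : is_derive x (1 : R) (fun y => expR (c * y)) (expR (c * x) * c).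
Proof. exact: is_derive_scale. Qed.

Let is_derive_sinc (c x : R) : is_derive x (1 : R) (fun y => sin (c * y)) (cos (c * x) * c).
Proof. by apply: (@is_derive_scale R _ cos). Qed.

Let is_derive_cosc (c x : R) : is_derive x (1 : R) (fun y => cos (c * y)) (- sin (c * x) * c).
Proof. by apply: (@is_derive_scale R _ (fun y => - sin y)). Qed.

Lemma is_derive_tre k (t x : R) : is_derive t (1 : R) ((tre k)^~ x) (tre k.+1 t x).
Proof.
apply: is_derive_sum_fun => i; have hE := is_derive_exp (lam i) t.
eapply is_derive_eq; first by derive_fun.
by rewrite /= exprS; ring.
Qed.

Lemma is_derive_tim k (t x : R) : is_derive t (1 : R) ((tim k)^~ x) (tim k.+1 t x).
Proof.
apply: is_derive_sum_fun => i; have hE := is_derive_exp (lam i) t.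
eapply is_derive_eq; first by derive_fun.
by rewrite /= exprS; ring.
Qed.

Lemma is_derive_tre_angle k (t x : R) : is_derive x (1 : R) (tre k t) (- tim k.+1 t x).
Proof.
rewrite /tim -sumrN.
apply: is_derive_sum_fun => i.
have hs := is_derive_sinc (lam i) x; have hc := is_derive_cosc (lam i) x.
eapply is_derive_eq; first by derive_fun.
by rewrite /= exprS; ring.
Qed.

Lemma is_derive_tim_angle k (t x : R) : is_derive x (1 : R) (tim k t) (tre k.+1 t x).
Proof.
apply: is_derive_sum_fun => i.
have hs := is_derive_sinc (lam i) x; have hc := is_derive_cosc (lam i) x.
eapply is_derive_eq; first by derive_fun.
by rewrite /= exprS; ring.
Qed.

Let continuous_fst_fun : contf (fun z : R * R => z.1).
Proof. by move=> z; exact: cvg_fst. Qed.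

Let continuous_snd_fun : contf (fun z : R * R => z.2).
Proof. by move=> z; exact: cvg_snd. Qed.

Lemma continuous_tre k : continuous (fun z : R * R => tre k z.1 z.2).
Proof.
apply: contf_sum => i; continuity; first [exact: continuous_fst_fun|exact: continuous_snd_fun].
Qed.

Lemma continuous_tim k : continuous (fun z : R * R => tim k z.1 z.2).
Proof.
apply: contf_sum => i; continuity; first [exact: continuous_fst_fun|exact: continuous_snd_fun].
Qed.

Lemma tre_bound (l t x : R) : (forall i, l <= lam i) -> t <= 0 ->
  `|tre 0 t x| <= (\sum_i (`|al i| + `|be i|)) * expR (l * t).
Proof.
move=> hl t0; rewrite /tre mulr_suml (le_trans (ler_norm_sum _ _ _))//.
apply: ler_sum => i _; rewrite expr0 mul1r normrM mulrC.
apply: ler_pM => //.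
  rewrite (le_trans (ler_normD _ _))// !normrM lerD// ler_piMr// ler_norml.
    by rewrite cos_geN1 cos_le1.
  by rewrite sin_geN1 sin_le1.
by rewrite ger0_norm ?expR_ge0// ler_expR ler_wnM2r.
Qed.

End trigonometric_sums.

(** Multiplying the complex coefficients by -i turns imaginary parts into real parts, so that the
    bound and the periodicity carry over from [tre] to [tim]. *)
Lemma timE (R : realType) (I : finType) (lam al be : I -> R) k (t x : R) :
  tim lam al be k t x = tre lam (fun i => - be i) al k t x.
Proof. by apply: eq_bigr => i _; ring. Qed.

Lemma tim_bound (R : realType) (I : finType) (lam al be : I -> R) (l t x : R) :
  (forall i, l <= lam i) -> t <= 0 ->
  `|tim lam al be 0 t x| <= (\sum_i (`|al i| + `|be i|)) * expR (l * t).
Proof.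
move=> hl t0; rewrite timE (le_trans (tre_bound _ _ _ hl t0))//.
by rewrite ler_wpM2r ?expR_ge0//; apply: ler_sum => i _; rewrite normrN addrC.
Qed.

Lemma tre_periodic (R : realType) (I : finType) (lam al be : I -> R) (T : R) k (t : R) :
  (forall i, cos (lam i * T) = 1 /\ sin (lam i * T) = 0) ->
  tre lam al be k t T = tre lam al be k t 0.
Proof.
by move=> hT; apply: eq_bigr => i _; have [hc hs] := hT i; rewrite hc hs !mulr0 cos0 sin0 mulr0.
Qed.

Lemma tim_periodic (R : realType) (I : finType) (lam al be : I -> R) (T : R) k (t : R) :
  (forall i, cos (lam i * T) = 1 /\ sin (lam i * T) = 0) ->
  tim lam al be k t T = tim lam al be k t 0.
Proof. by move=> hT; rewrite !timE; exact: tre_periodic. Qed.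

Section continuous_sph.
Context (R : realType) (T : topologicalType).
Variables (a s w e B : R).
Hypothesis e0 : 0 < e.

Lemma contf_sph (x y : T -> R) : contf x -> contf y ->
  contf (fun z => sph a s w e B (x z) (y z)).
Proof.
move=> cx cy; rewrite /sph; continuity => z; first [exact: sq_gt0|exact: sq2_gt0].
Qed.

Lemma contf_sph1 (x y p q : T -> R) : contf x -> contf y -> contf p -> contf q ->
  contf (fun z => sph1 a s w e B (x z) (y z) (p z) (q z)).
Proof.
move=> cx cy cp cq; rewrite /sph1; continuity => z; first [exact: sq_gt0|exact: sq2_gt0].
Qed.

Lemma contf_sph2 (x y p q p' q' : T -> R) : contf x -> contf y ->
  contf p -> contf q -> contf p' -> contf q' ->
  contf (fun z => sph2 a s w e B (x z) (y z) (p z) (q z) (p' z) (q' z)).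
Proof.
move=> cx cy cp cq cp' cq'; rewrite /sph2/=; continuity => z;
  first [exact: sq_gt0|exact: sq2_gt0].
Qed.

End continuous_sph.

(** * The theorem of M. Riesz on conjugate functions *)

Section riesz.
Context (R : realType).
Local Notation mu := (@lebesgue_measure R).

Lemma contf_integrable (f : R -> R) (a b : R) :
  contf f -> mu.-integrable `[a, b] (EFin \o f).
Proof. exact: continuous_integrable_itv. Qed.

Lemma ge0_le_Rintegral_continuous (f g : R -> R) (a b : R) : contf f -> contf g ->
  (forall x, f x <= g x) ->
  \int[mu]_(x in `[a, b]) f x <= \int[mu]_(x in `[a, b]) g x.
Proof.
by move=> cf cg fg; apply: le_Rintegral => //; exact: contf_integrable.
Qed.

Lemma Rintegral_cst_itv (c T : R) : 0 <= T -> \int[mu]_(x in `[0, T]) c = c * T.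
Proof.
move=> T0; rewrite Rintegral_cst//= lebesgue_measure_itv/= lte_fin.
by case: ltgtP T0 => //= [T0 _|<- _]; rewrite ?oppr0 ?addr0// -EFinD subr0.
Qed.

Lemma small_exponential (K e l : R) : 0 <= K -> 0 < e -> 0 < l ->
  exists2 t, t <= 0 & K * expR (l * t) <= e.
Proof.
move=> K0 e0 l0; have c0 : 0 < e / (K + e) by rewrite divr_gt0// ltr_wpDl.
exists (ln (e / (K + e)) / l).
  rewrite pmulr_lle0 ?invr_gt0// ln_le0// ler_pdivrMr ?ltr_wpDl// mul1r lerDr//.
rewrite [l * _]mulrC divfK ?gt_eqF// lnK// mulrA ler_pdivrMr ?ltr_wpDl//.
by rewrite mulrC ler_wpM2l ?(ltW e0)// lerDl ltW.
Qed.

Section sph_cylinder.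
Variables (u v : nat -> R -> R -> R) (T e a s w B C : R).

(** By the Cauchy-Riemann relations, moving along [x] instead of [t] replaces the velocity
    [(u 1, v 1)] by [(- v 1, u 1)]; these are the two directions of [sph_subharmonic]. *)
Lemma sph_submean : 0 < T ->
  (forall k t x, is_derive t (1 : R) ((u k)^~ x) (u k.+1 t x)) ->
  (forall k t x, is_derive t (1 : R) ((v k)^~ x) (v k.+1 t x)) ->
  (forall k t x, is_derive x (1 : R) (u k t) (- v k.+1 t x)) ->
  (forall k t x, is_derive x (1 : R) (v k t) (u k.+1 t x)) ->
  (forall k, contf (fun z : R * R => u k z.1 z.2)) ->
  (forall k, contf (fun z : R * R => v k z.1 z.2)) ->
  (forall k t, u k t T = u k t 0) -> (forall k t, v k t T = v k t 0) ->
  (forall t x, t <= 0 -> sph a s w e B (u 0 t x) (v 0 t x) <= C) ->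
  0 < e -> s <= 1 -> 1 < 2 * s -> 0 <= w -> a = s + w ->
  B * (2 * s * (2 * s - 1)) = 4 * a * (a + 1) ->
  forall t, t <= 0 ->
    \int[mu]_(x in `[0, T]) sph a s w e B (u 0 t x) (v 0 t x) <=
    \int[mu]_(x in `[0, T]) sph a s w e B (u 0 0 x) (v 0 0 x).
Proof.
move=> T0 ut vt ux vx cu cv uT vT bC e0 s1 s2 w0 aE BE.
pose f2 t x := sph2 a s w e B (u 0 t x) (v 0 t x) (u 1 t x) (v 1 t x) (u 2 t x) (v 2 t x).
pose g2 t x := sph2 a s w e B (u 0 t x) (v 0 t x) (- v 1 t x) (u 1 t x) (- u 2 t x) (- v 2 t x).
pose f1 t x := sph1 a s w e B (u 0 t x) (v 0 t x) (u 1 t x) (v 1 t x).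
pose g t x := sph1 a s w e B (u 0 t x) (v 0 t x) (- v 1 t x) (u 1 t x).
pose f t x := sph a s w e B (u 0 t x) (v 0 t x).
have H1 t x : is_derive t (1 : R) (f^~ x) (f1 t x).
  exact: (@is_derive_sph R a s w e B e0 ((u 0)^~ x) ((v 0)^~ x) t _ _ (ut 0 t x) (vt 0 t x)).
have H2 t x : is_derive t (1 : R) (f1^~ x) (f2 t x).
  exact: (@is_derive_sph1 R a s w e B e0 ((u 0)^~ x) ((v 0)^~ x) ((u 1)^~ x) ((v 1)^~ x) t _ _
    (ut 0 t x) (vt 0 t x) (ut 1 t x) (vt 1 t x)).
have H3 t x : is_derive x (1 : R) (g t) (g2 t x).
  exact: (@is_derive_sph1 R a s w e B e0 (u 0 t) (v 0 t) (fun x => - v 1 t x) (u 1 t) x _ _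
    (ux 0 t x) (vx 0 t x) (is_deriveN_fun (vx 1 t x)) (ux 1 t x)).
have cf : contf (fun z : R * R => f z.1 z.2) by exact: contf_sph.
have cf1 : contf (fun z : R * R => f1 z.1 z.2) by exact: contf_sph1.
have cf2 : contf (fun z : R * R => f2 z.1 z.2) by exact: contf_sph2.
have cg2 : contf (fun z : R * R => g2 z.1 z.2).
  by apply: contf_sph2 => //; exact: contfN.
have H4 t x : 0 <= f2 t x + g2 t x by exact: sph_subharmonic.
have H5 t : g t T = g t 0 by rewrite /g !uT !vT.
exact: (@cylinder_submean R T f f1 f2 g g2 C T0 H1 H2 H3 cf cf1 cf2 cg2 H4 H5 bC).
Qed.

End sph_cylinder.

Section exponents.
Variables (I : finType) (lam al be : I -> R) (l T e a s w B : R).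

Local Notation re := (tre lam al be 0 0).
Local Notation im := (tim lam al be 0 0).

Lemma riesz_regularized : 0 < l -> (forall i, l <= lam i) -> 0 < T ->
  (forall i, cos (lam i * T) = 1 /\ sin (lam i * T) = 0) ->
  0 < e -> s <= 1 -> 1 < 2 * s -> 0 <= w -> a = s + w ->
  B * (2 * s * (2 * s - 1)) = 4 * a * (a + 1) ->
  \int[mu]_(x in `[0, T]) ((re x ^+ 2 + im x ^+ 2 + e) `^ a) <=
  \int[mu]_(x in `[0, T])
     (B * ((re x ^+ 2 + e) `^ s * (re x ^+ 2 + im x ^+ 2 + e) `^ w))
   + (2 * e) `^ a * T.
Proof.
move=> l0 hl T0 hT e0 s1 s2 w0 aE BE.
have a0 : 0 < a by rewrite aE; lra.
have B0 : 0 <= B.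
  have k0 : 0 < 2 * s * (2 * s - 1) by rewrite mulr_gt0//; lra.
  by rewrite -(pmulr_lge0 _ k0) BE mulr_ge0//; lra.
pose u k t x := tre lam al be k t x; pose v k t x := tim lam al be k t x.
have cu k : contf (fun z : R * R => u k z.1 z.2) by exact: continuous_tre.
have cv k : contf (fun z : R * R => v k z.1 z.2) by exact: continuous_tim.
have ut k t x : is_derive t (1 : R) ((u k)^~ x) (u k.+1 t x) by exact: is_derive_tre.
have vt k t x : is_derive t (1 : R) ((v k)^~ x) (v k.+1 t x) by exact: is_derive_tim.
have ux k t x : is_derive x (1 : R) (u k t) (- v k.+1 t x) by exact: is_derive_tre_angle.
have vx k t x : is_derive x (1 : R) (v k t) (u k.+1 t x) by exact: is_derive_tim_angle.
pose M : R := \sum_i (`|al i| + `|be i|).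
have M0 : 0 <= M by apply: sumr_ge0 => i _; rewrite addr_ge0.
have ub t x : t <= 0 -> u 0 t x ^+ 2 <= M ^+ 2 * expR (2 * l * t).
  move=> t0; rewrite -mulrA expRM_natl -exprMn -real_normK ?num_real//.
  by rewrite lerXn2r ?nnegrE ?mulr_ge0 ?expR_ge0//; exact: tre_bound.
have vb t x : t <= 0 -> v 0 t x ^+ 2 <= M ^+ 2 * expR (2 * l * t).
  move=> t0; rewrite -mulrA expRM_natl -exprMn -real_normK ?num_real//.
  by rewrite lerXn2r ?nnegrE ?mulr_ge0 ?expR_ge0//; exact: tim_bound.
have M20 : 0 <= M ^+ 2 by rewrite sqr_ge0.
have exp1 t : t <= 0 -> expR (2 * l * t) <= 1.
  by move=> t0; rewrite -expR0 ler_expR pmulr_rle0// mulr_gt0.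
have key t : t <= 0 -> \int[mu]_(x in `[0, T]) sph a s w e B (u 0 t x) (v 0 t x) <=
    \int[mu]_(x in `[0, T]) sph a s w e B (u 0 0 x) (v 0 0 x).
  move: t; apply: (@sph_submean u v T e a s w B
    (B * ((M ^+ 2 + e) `^ s * (M ^+ 2 + M ^+ 2 + e) `^ w))) => //.
  - by move=> k t; exact: tre_periodic.
  - by move=> k t; exact: tim_periodic.
  - move=> t x t0; rewrite /sph.
    have u1 : u 0 t x ^+ 2 <= M ^+ 2 by rewrite (le_trans (ub _ _ t0))// ler_piMr// exp1.
    have v1 : v 0 t x ^+ 2 <= M ^+ 2 by rewrite (le_trans (vb _ _ t0))// ler_piMr// exp1.
    have hu := sqr_ge0 (u 0 t x); have hv := sqr_ge0 (v 0 t x).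
    rewrite (@le_trans _ _ (B * ((u 0 t x ^+ 2 + e) `^ s * (u 0 t x ^+ 2 + v 0 t x ^+ 2 + e) `^ w)))//.
      by rewrite gerBl powR_ge0.
    rewrite ler_wpM2l// ler_pM ?powR_ge0// ge0_ler_powR ?nnegrE//; lra.
(* Close enough to -oo for u^2 + v^2 <= [e] to hold: there [sph] is at least -(2e)^a, which produces
   the last term of the conclusion. *)
have [t t0 ht] : exists2 t, t <= 0 & (2 * M ^+ 2) * expR (2 * l * t) <= e.
  by apply: small_exponential; rewrite ?mulr_ge0 ?mulr_gt0.
have cX0 : contf (fun x => u 0 0 x) by exact: (continuous2_curry (cu 0)).
have cY0 : contf (fun x => v 0 0 x) by exact: (continuous2_curry (cv 0)).
have cX : contf (fun x => u 0 t x) by exact: (continuous2_curry (cu 0)).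
have cY : contf (fun x => v 0 t x) by exact: (continuous2_curry (cv 0)).
have h x := @le_trans _ _ _ x _ ^~ (key t t0).
have /h : - ((2 * e) `^ a * T) <= \int[mu]_(x in `[0, T]) sph a s w e B (u 0 t x) (v 0 t x).
  rewrite -mulNr -(Rintegral_cst_itv _ (ltW T0)).
  apply: ge0_le_Rintegral_continuous; [exact: contf_cst|exact: contf_sph|].
  move=> x; rewrite /sph.
  rewrite (@le_trans _ _ (- (u 0 t x ^+ 2 + v 0 t x ^+ 2 + e) `^ a))//.
    have hu := sqr_ge0 (u 0 t x); have hv := sqr_ge0 (v 0 t x).
    have := ub _ x t0; have := vb _ x t0 => hvb hub.
    by rewrite lerN2 ge0_ler_powR ?nnegrE ?(ltW a0)//; lra.
  by rewrite lerDr mulr_ge0// mulr_ge0// powR_ge0.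
rewrite /sph RintegralB//.
- by rewrite lerBrDr addrC lerBlDr.
- apply: contf_integrable; continuity => x; first [exact: sq_gt0|exact: sq2_gt0].
- apply: contf_integrable; continuity => x; first [exact: sq_gt0|exact: sq2_gt0].
Qed.

End exponents.
End riesz.

(** * The L_q bound for the conjugate function *)

Section conjugate.
Context (R : realType).
Local Notation mu := (@lebesgue_measure R).

Lemma powR_sum_le (x y p : R) : 0 <= x -> 0 <= y -> 0 <= p ->
  (x + y) `^ p <= 2 `^ p * (x `^ p + y `^ p).
Proof.
move=> x0 y0 p0; wlog xy : x y x0 y0 / x <= y.
  by move=> h; case/orP: (le_total x y) => xy; [exact: h|rewrite addrC [in leRHS]addrC; exact: h].
rewrite (@le_trans _ _ ((2 * y) `^ p))//.
  by rewrite ge0_ler_powR ?nnegrE ?addr_ge0 ?mulr_ge0//; lra.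
by rewrite powRM// ler_wpM2l ?powR_ge0// lerDr powR_ge0.
Qed.

Lemma normr_powR_sqr (x p : R) : `|x| `^ (2 * p) = (x ^+ 2) `^ p.
Proof. by rewrite powRrM powR_mulrn// real_normK ?num_real. Qed.

(** A Young inequality with a free parameter, obtained by comparing [X] with [k * P]. A small [k]
    makes the part in [P] absorbable, at the price of a large constant on the part in [X]. *)
Lemma powR_weighted_le (X P k s w : R) : 0 < X -> 0 < P -> 0 < k -> 0 <= s -> 0 <= w ->
  X `^ s * P `^ w <= k `^ s * P `^ (s + w) + k `^ (- w) * X `^ (s + w).
Proof.
move=> X0 P0 k0 s0 w0; have [XP|PX] := leP X (k * P).
  rewrite ler_wpDr ?mulr_ge0 ?powR_ge0//.
  rewrite powRD ?(gt_eqF P0) ?implybT// mulrA ler_wpM2r ?powR_ge0//.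
  rewrite -powRM ?(ltW k0) ?(ltW P0)//; apply: ge0_ler_powR => //;
    by rewrite nnegrE ?mulr_ge0 ?(ltW X0) ?(ltW k0) ?(ltW P0).
rewrite ler_wpDl ?mulr_ge0 ?powR_ge0//.
rewrite powRD ?(gt_eqF X0) ?implybT// mulrCA ler_wpM2l ?powR_ge0//.
rewrite powRN mulrC ler_pdivlMr ?powR_gt0// -powRM ?(ltW k0) ?(ltW P0)//.
apply: ge0_ler_powR => //; last by rewrite mulrC ltW.
  by rewrite nnegrE mulr_ge0 ?(ltW k0) ?(ltW P0).
by rewrite nnegrE ltW.
Qed.

Let absorb (V P Q X A J E T D : R) : V <= P -> P <= Q + E * T ->
  Q <= 2^-1 * P + 2^-1 * D * X -> D * X <= D * (A * J + E * T) ->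
  V <= D * A * J + (D + 2) * T * E.
Proof. by move=> *; lra. Qed.

(** The constant is fixed before the index set, the frequencies and the period: this uniformity in
    the number of terms is what a Grunblum inequality requires. *)
Lemma conjugate_bound (q : R) : 1 < q -> exists2 C : R, 0 <= C &
  forall (I : finType) (lam al be : I -> R) (l T : R), 0 < l -> (forall i, l <= lam i) -> 0 < T ->
  (forall i, cos (lam i * T) = 1 /\ sin (lam i * T) = 0) ->
  \int[mu]_(x in `[0, T]) (`|tim lam al be 0 0 x| `^ q) <=
  C * \int[mu]_(x in `[0, T]) (`|tre lam al be 0 0 x| `^ q).
Proof.
move=> q1; pose a := q / 2; pose s := Num.min 1 a; pose w := a - s.
have s1 : s <= 1 by rewrite ge_min lexx.
have s2 : 1 < 2 * s by rewrite /s /a; case: (leP 1 (q / 2)) => _; lra.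
have w0 : 0 <= w by rewrite subr_ge0 ge_min lexx orbT.
have aE : a = s + w by rewrite /w; ring.
clearbody w; clearbody s.
have a0 : 0 < a by rewrite /a; lra.
have qE : q = 2 * a by rewrite /a; lra.
clearbody a.
(* The value demanded by [sph_subharmonic]. *)
pose B := 4 * a * (a + 1) / (2 * s * (2 * s - 1)).
have k0 : 0 < 2 * s * (2 * s - 1) by rewrite mulr_gt0//; lra.
have BE : B * (2 * s * (2 * s - 1)) = 4 * a * (a + 1) by rewrite divfK// gt_eqF.
have B0 : 0 < B by rewrite divr_gt0// !mulr_gt0//; lra.
clearbody B.
pose k := (2 * B)^-1 `^ s^-1.
have k0' : 0 < k by rewrite powR_gt0// invr_gt0 mulr_gt0.
have kE : k `^ s = (2 * B)^-1.
  by rewrite -powRrM mulVf ?powRr1 ?invr_ge0 ?mulr_ge0 ?(ltW B0)// gt_eqF//; lra.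
clearbody k.
pose D := 2 * B * k `^ (- w).
have D0 : 0 <= D by rewrite !mulr_ge0 ?powR_ge0 ?(ltW B0).
exists (D * 2 `^ a); first by rewrite mulr_ge0// powR_ge0.
move=> I lam al be l T l0 hl T0 hT.
pose u x := tre lam al be 0 0 x; pose v x := tim lam al be 0 0 x.
have cu : contf u by exact: (continuous2_curry (@continuous_tre _ _ lam al be 0)).
have cv : contf v by exact: (continuous2_curry (@continuous_tim _ _ lam al be 0)).
have reg e (e0 : 0 < e) := riesz_regularized al be l0 hl T0 hT e0 s1 s2 w0 aE BE.
rewrite -/u -/v in reg *.
have {}reg e (e0 : 0 < e) :
  \int[mu]_(x in `[0, T]) ((u x ^+ 2 + v x ^+ 2 + e) `^ a) <=
  \int[mu]_(x in `[0, T])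
     (B * ((u x ^+ 2 + e) `^ s * (u x ^+ 2 + v x ^+ 2 + e) `^ w))
   + (2 * e) `^ a * T by exact: reg.
suff : \int[mu]_(x in `[0, T]) (`|v x| `^ q) <=
    D * 2 `^ a * \int[mu]_(x in `[0, T]) (`|u x| `^ q) by [].
clearbody u v.
set J := \int[mu]_(x in `[0, T]) (`|u x| `^ q).
have q0 : 0 < q by rewrite qE mulr_gt0.
have intu : mu.-integrable `[0, T] (EFin \o (fun x => `|u x| `^ q)).
  by apply: contf_integrable; exact: contf_norm_powR.
have J0 : 0 <= J by apply: Rintegral_ge0 => x _; exact: powR_ge0.
have main e (e0 : 0 < e) : \int[mu]_(x in `[0, T]) (`|v x| `^ q) <=
    D * 2 `^ a * J + (D + 2) * T * (2 * e) `^ a.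
  have hX x : 0 < u x ^+ 2 + e by exact: sq_gt0.
  have hP x : 0 < u x ^+ 2 + v x ^+ 2 + e by exact: sq2_gt0.
  set P := \int[mu]_(x in `[0, T]) ((u x ^+ 2 + v x ^+ 2 + e) `^ a) in reg.
  have cP : contf (fun x => (u x ^+ 2 + v x ^+ 2 + e) `^ a) by continuity.
  have cX : contf (fun x => (u x ^+ 2 + e) `^ a) by continuity.
  have vP : \int[mu]_(x in `[0, T]) (`|v x| `^ q) <= P.
    apply: ge0_le_Rintegral_continuous => //; first exact: contf_norm_powR.
    move=> x; rewrite qE normr_powR_sqr ge0_ler_powR ?nnegrE ?(ltW a0) ?sqr_ge0 ?(ltW (hP x))//.
    by have := sqr_ge0 (u x); lra.
  have cU : contf (fun x => `|u x| `^ q) by exact: contf_norm_powR.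
  have cUe : contf (fun x => 2 `^ a * `|u x| `^ q + (2 * e) `^ a) by continuity.
  have XJ : \int[mu]_(x in `[0, T]) ((u x ^+ 2 + e) `^ a) <= 2 `^ a * J + (2 * e) `^ a * T.
    rewrite -(Rintegral_cst_itv _ (ltW T0)) /J -RintegralZl// -RintegralD//.
    - apply: ge0_le_Rintegral_continuous => //.
      move=> x; rewrite (le_trans (powR_sum_le _ _ _)) ?sqr_ge0 ?(ltW e0) ?(ltW a0)//.
      by rewrite mulrDr qE normr_powR_sqr [(2 * e) `^ a]powRM ?(ltW e0).
    - by apply: contf_integrable; apply: (@contfM _ R) => //; exact: contf_cst.
    - by apply: contf_integrable; exact: contf_cst.
  have PX : \int[mu]_(x in `[0, T])
       (B * ((u x ^+ 2 + e) `^ s * (u x ^+ 2 + v x ^+ 2 + e) `^ w)) <=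
      2^-1 * P + 2^-1 * D * \int[mu]_(x in `[0, T]) ((u x ^+ 2 + e) `^ a).
    rewrite /P -RintegralZl//; last exact: contf_integrable.
    rewrite -RintegralZl//; last exact: contf_integrable.
    rewrite -RintegralD//; last 2 first.
      by apply: contf_integrable; continuity.
      by apply: contf_integrable; continuity.
    apply: ge0_le_Rintegral_continuous; [by continuity|by continuity|] => x.
    rewrite (@le_trans _ _ (B * (k `^ s * (u x ^+ 2 + v x ^+ 2 + e) `^ (s + w)
        + k `^ (- w) * (u x ^+ 2 + e) `^ (s + w))))//.
      by rewrite ler_wpM2l ?(ltW B0)//; apply: powR_weighted_le => //; lra.
    rewrite -aE kE /D le_eqVlt; apply/orP; left; apply/eqP; field.
    by rewrite gt_eqF.
  exact: absorb vP (reg _ e0) PX (ler_wpM2l D0 XJ).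
apply/ler_addgt0Pr => d d0.
have K0 : 0 < (D + 2) * T by rewrite mulr_gt0// ltr_wpDl.
pose e := (d / ((D + 2) * T)) `^ a^-1 / 2.
have e0 : 0 < e by rewrite divr_gt0// powR_gt0// divr_gt0.
apply: (le_trans (main e e0)); rewrite lerD2l /e mulrC [2 * _]mulrC divfK// -powRrM mulVf ?gt_eqF//.
by rewrite powRr1 ?divfK ?gt_eqF// divr_ge0 ?ltW.
Qed.

End conjugate.

(** * Truncation of sine sums by modulation *)

Section sine_partial_sums.
Context (R : realType).
Local Notation mu := (@lebesgue_measure R).

Definition sinesum (a : nat -> R) (N : nat) (x : R) : R :=
  \sum_(n < N) a n * sin (n.+1%:R * pi * x).

Lemma contf_sinesum a N : contf (sinesum a N).
Proof. by apply: contf_sum => i; continuity. Qed.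

Lemma cos_sin_nat2pi (n : nat) : cos (n%:R * (2 * pi)) = 1 :> R /\ sin (n%:R * (2 * pi)) = 0 :> R.
Proof.
elim: n => [|n [hc hs]]; first by rewrite mul0r cos0 sin0.
have -> : n.+1%:R * (2 * pi) = n%:R * (2 * pi) + pi *+ 2 :> R.
  by rewrite -natr1 mulr2n; ring.
by rewrite cosD2pi sinD2pi.
Qed.

Section modulation.
Variables (a : nat -> R) (m N : nat).

(** With [w] the modulating frequency, these are (n+1) pi + w and |(n+1) pi - w|. Natural-number
    subtraction shows at once that they are odd multiples of pi/2, hence at least pi/2; [sg] records
    the sign lost in the absolute value. *)
Let freq (i : 'I_N * bool) : R :=
  ((if i.2 then (i.1 + m).+1 else if (m <= i.1)%N then i.1 - m else m - i.1.+1)%N%:R + 2^-1) * pi.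
Let sg (n : nat) : R := if (m <= n)%N then 1 else -1.
Let w : R := (m%:R + 2^-1) * pi.

Let freq_true n : freq (n, true) = n.+1%:R * pi + w.
Proof. by rewrite /freq /w/= -addSn natrD; ring. Qed.

Let freq_false n : freq (n, false) = sg n * (n.+1%:R * pi - w).
Proof.
by rewrite /freq /w /sg/=; have [mn|mn] := leqP m n; rewrite (natrB _ mn) -natr1; field.
Qed.

Let sin_sg n x : sin (sg n * x) = sg n * sin x.
Proof. by rewrite /sg; case: ifP => _; rewrite ?mul1r// !mulN1r sinN. Qed.

Let cos_sg n x : cos (sg n * x) = cos x.
Proof. by rewrite /sg; case: ifP => _; rewrite ?mul1r// !mulN1r cosN. Qed.

Let cos_true n x : cos (freq (n, true) * x) =
  cos (n.+1%:R * pi * x) * cos (w * x) - sin (n.+1%:R * pi * x) * sin (w * x).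
Proof. by rewrite freq_true mulrDl cosD. Qed.

Let sin_true n x : sin (freq (n, true) * x) =
  sin (n.+1%:R * pi * x) * cos (w * x) + cos (n.+1%:R * pi * x) * sin (w * x).
Proof. by rewrite freq_true mulrDl sinD. Qed.

Let cos_false n x : cos (freq (n, false) * x) =
  cos (n.+1%:R * pi * x) * cos (w * x) + sin (n.+1%:R * pi * x) * sin (w * x).
Proof. by rewrite freq_false -mulrA cos_sg mulrBl cosB. Qed.

Let sin_false n x : sin (freq (n, false) * x) = sg n *
  (sin (n.+1%:R * pi * x) * cos (w * x) - cos (n.+1%:R * pi * x) * sin (w * x)).
Proof. by rewrite freq_false -mulrA sin_sg mulrBl sinB. Qed.

(** Product-to-sum formulas: [bes] holds the sine coefficients of the sum times cos (w x), [alc] the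
    cosine coefficients of the sum times sin (w x). The factor [sg] compensates for the absolute
    value in [freq]. *)
Let bes (i : 'I_N * bool) : R := (if i.2 then 1 else sg i.1) * (a i.1 / 2).
Let alc (i : 'I_N * bool) : R := (if i.2 then -1 else 1) * (a i.1 / 2).

Let split_sum (F : 'I_N * bool -> R) : \sum_i F i = \sum_(n < N) (F (n, true) + F (n, false)).
Proof.
transitivity (\sum_(n < N) \sum_(b : bool) F (n, b)).
  by rewrite pair_bigA; apply: eq_bigr => -[].
by apply: eq_bigr => n _; rewrite big_bool.
Qed.

Let re_cos x : tre freq (fun=> 0) bes 0 0 x = sinesum a N x * cos (w * x).
Proof.
rewrite /tre split_sum mulr_suml; apply: eq_bigr => n _.
rewrite !expr0 !mulr0 expR0 !mul0r /bes sin_true sin_false /=.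
by rewrite /sg; case: ifP => _; field.
Qed.

Let re_sin x : tre freq alc (fun=> 0) 0 0 x = sinesum a N x * sin (w * x).
Proof.
rewrite /tre split_sum mulr_suml; apply: eq_bigr => n _.
rewrite !expr0 !mulr0 expR0 !mul0r /alc cos_true cos_false /=.
by field.
Qed.

(* Multiplication by [cos (w x)] and [sin (w x)] shifts the frequencies by [w],
   which sits halfway between [m pi] and [(m+1) pi]: conjugating and shifting
   back only keeps the frequencies below [w]. *)
Let demodulation x : (m <= N)%N -> sinesum a m x =
  sin (w * x) * tim freq (fun=> 0) bes 0 0 x - cos (w * x) * tim freq alc (fun=> 0) 0 0 x.
Proof.
move=> mN; rewrite /sinesum (big_ord_widen N (fun n => a n * sin (n.+1%:R * pi * x)) mN).
rewrite /tim !split_sum !mulr_sumr -sumrB [LHS]big_mkcond/=; apply: eq_bigr => n _.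
rewrite !expr0 !mulr0 expR0 !mul0r /alc /bes cos_true cos_false sin_true sin_false /=.
have := cos2Dsin2 (w * x).
set S := sin (n.+1%:R * pi * x); set c := cos (w * x); set s := sin (w * x) => cs.
(* (1 - sg n) / 2 is the indicator of n < m: the sign reversal of the frequencies below [w] performs
   the truncation. *)
have -> : (if (n < m)%N then a n * S else 0) = 2^-1 * (1 - sg n) * a n * S * (c ^+ 2 + s ^+ 2).
  by rewrite cs /sg ltnNge; case: leqP => _ /=; field.
by field.
Qed.

Let combine (Jm J1 J2 J k C : R) : Jm <= k * (J1 + J2) -> J1 <= C * J -> J2 <= C * J ->
  0 <= k -> Jm <= k * (2 * C) * J.
Proof.
move=> h h1 h2 k0; apply: (le_trans h); rewrite -mulrA ler_wpM2l//.
by apply: (le_trans (lerD h1 h2)); lra.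
Qed.

Lemma sine_partial_bound q C : 1 < q -> 0 <= C -> (m <= N)%N ->
  (forall (I : finType) (lam al be : I -> R) (l T : R), 0 < l -> (forall i, l <= lam i) -> 0 < T ->
  (forall i, cos (lam i * T) = 1 /\ sin (lam i * T) = 0) ->
  \int[mu]_(x in `[0, T]) (`|tim lam al be 0 0 x| `^ q) <=
  C * \int[mu]_(x in `[0, T]) (`|tre lam al be 0 0 x| `^ q)) ->
  \int[mu]_(x in `[0, 4]) (`|sinesum a m x| `^ q) <=
  2 `^ q * (2 * C) * \int[mu]_(x in `[0, 4]) (`|sinesum a N x| `^ q).
Proof.
move=> q1 C0 mN HC; have q0 : 0 < q by rewrite (lt_trans ltr01).
have l0 : 0 < 2^-1 * pi :> R by rewrite mulr_gt0// pi_gt0.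
have hl i : 2^-1 * pi <= freq i by rewrite ler_wpM2r ?pi_ge0// lerDr ler0n.
(* Odd multiples of pi/2 have the common period 4. *)
have hT i : cos (freq i * 4) = 1 /\ sin (freq i * 4) = 0.
  rewrite /freq; set d := (X in X%:R).
  have -> : (d%:R + 2^-1) * pi * 4 = (2 * d + 1)%N%:R * (2 * pi) :> R.
    by rewrite natrD natrM; field.
  exact: cos_sin_nat2pi.
have HC1 := HC _ freq (fun=> 0) bes _ _ l0 hl (ltr0n _ 4) hT.
have HC2 := HC _ freq alc (fun=> 0) _ _ l0 hl (ltr0n _ 4) hT.
set i1 := tim freq (fun=> 0) bes 0 0 in HC1; set i2 := tim freq alc (fun=> 0) 0 0 in HC2.
have c1 : contf i1 by exact: (continuous2_curry (@continuous_tim _ _ freq (fun=> 0) bes 0)).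
have c2 : contf i2 by exact: (continuous2_curry (@continuous_tim _ _ freq alc (fun=> 0) 0)).
have cf := @contf_sinesum a N; have cm := @contf_sinesum a m.
have le_f g h : contf g -> (forall x, g x = sinesum a N x * h x) -> (forall x, `|h x| <= 1) ->
    \int[mu]_(x in `[0, 4]) (`|g x| `^ q) <= \int[mu]_(x in `[0, 4]) (`|sinesum a N x| `^ q).
  move=> cg gE h1; apply: ge0_le_Rintegral_continuous; [exact: contf_norm_powR..|].
  move=> x; rewrite ge0_ler_powR ?nnegrE ?(ltW q0)// gE normrM ler_piMr//.
have r1 := le_f _ _ (continuous2_curry (@continuous_tre _ _ freq (fun=> 0) bes 0)) re_cos
  (fun x => cos_max _).
have r2 := le_f _ _ (continuous2_curry (@continuous_tre _ _ freq alc (fun=> 0) 0)) re_sin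
  (fun x => sin_max _).
have {}HC1 := le_trans HC1 (ler_wpM2l C0 r1).
have {}HC2 := le_trans HC2 (ler_wpM2l C0 r2).
have i1q : contf (fun x => `|i1 x| `^ q) by exact: contf_norm_powR.
have i2q : contf (fun x => `|i2 x| `^ q) by exact: contf_norm_powR.
have le12 : \int[mu]_(x in `[0, 4]) (`|sinesum a m x| `^ q) <=
    \int[mu]_(x in `[0, 4]) (2 `^ q * (`|i1 x| `^ q + `|i2 x| `^ q)).
  apply: ge0_le_Rintegral_continuous.
  - exact: contf_norm_powR.
  - by apply: (@contfM _ R) => //; [exact: contf_cst|exact: contfD].
  - move=> x; rewrite (le_trans _ (powR_sum_le _ _ _)) ?(ltW q0)//.
    rewrite ge0_ler_powR ?nnegrE ?(ltW q0) ?addr_ge0// demodulation//.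
    rewrite (le_trans (ler_normB _ _))// !normrM lerD// ler_piMl//.
      exact: sin_max.
    exact: cos_max.
have intE : \int[mu]_(x in `[0, 4]) (2 `^ q * (`|i1 x| `^ q + `|i2 x| `^ q)) =
    2 `^ q * (\int[mu]_(x in `[0, 4]) (`|i1 x| `^ q) + \int[mu]_(x in `[0, 4]) (`|i2 x| `^ q)).
  rewrite RintegralZl//; last by apply: contf_integrable; exact: contfD.
  by rewrite RintegralD//; exact: contf_integrable.
rewrite intE in le12.
exact: combine le12 HC1 HC2 (powR_ge0 _ _).
Qed.

End modulation.

End sine_partial_sums.

(** * Classes of functions in L_q(0,1) *)

Section Lclass_total.
Context (R : realType) (q : R) (q1 : 1 < q).
Local Notation mu := (@lebesgue_measure R).
Local Notation T := (measurableTypeR R).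
Local Notation Lf := (LfunType (leb01 R) (Lexponent_ge1 q1)).

(* Total in [f]: the zero class when [f] is not in [Lfun]. *)
Definition Lcl (f : R -> R) : L01 q1 :=
  Lclass (insubd (0 : Lf) (f : T -> R)).

Definition inL (f : R -> R) := (f : T -> R) \in Lfun (leb01 R) q%:E.

Lemma Lcl_Sub (f : R -> R) (Hf : inL f) :
  Lcl f = Lclass (Lfun_Sub (Lexponent_ge1 q1) Hf).
Proof.
rewrite /Lcl; congr Lclass; apply: val_inj; rewrite val_insubd.
by rewrite [X in if X then _ else _]Hf.
Qed.

Lemma inLD (f g : R -> R) : inL f -> inL g -> inL (fun x => f x + g x).
Proof.
move=> hf hg; have := LfunP (Lfun_Sub (Lexponent_ge1 q1) hf + Lfun_Sub (Lexponent_ge1 q1) hg).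
exact.
Qed.

Lemma inLZ (c : R) (f : R -> R) : inL f -> inL (fun x => c * f x).
Proof.
move=> hf; have := LfunP (c *: Lfun_Sub (Lexponent_ge1 q1) hf).
exact.
Qed.

Lemma LclD (f g : R -> R) : inL f -> inL g -> Lcl (fun x => f x + g x) = Lcl f + Lcl g.
Proof.
move=> hf hg; rewrite (Lcl_Sub (inLD hf hg)) (Lcl_Sub hf) (Lcl_Sub hg) -LclassD.
by congr Lclass; exact/LfuneqP.
Qed.

Lemma LclZ (c : R) (f : R -> R) : inL f -> Lcl (fun x => c * f x) = c *: Lcl f.
Proof.
move=> hf; rewrite (Lcl_Sub (inLZ c hf)) (Lcl_Sub hf) -LclassZ.
by congr Lclass; exact/LfuneqP.
Qed.

Lemma inL_cst (c : R) : inL (fun=> c).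
Proof. exact: Lfun_cst. Qed.

Lemma inL_sum (I : Type) (r : seq I) (f : I -> R -> R) : (forall i, inL (f i)) ->
  inL (fun x => \sum_(i <- r) f i x).
Proof.
move=> hf; elim: r => [|i r IH].
  rewrite (_ : (fun _ => _) = (fun=> 0)); first exact: inL_cst.
  by apply/funext => x; rewrite big_nil.
rewrite (_ : (fun _ => _) = (fun x => f i x + \sum_(j <- r) f j x)).
  exact: inLD.
by apply/funext => x; rewrite big_cons.
Qed.

Lemma Lcl_sum (I : Type) (r : seq I) (f : I -> R -> R) : (forall i, inL (f i)) ->
  Lcl (fun x => \sum_(i <- r) f i x) = \sum_(i <- r) Lcl (f i).
Proof.
move=> hf; elim: r => [|i r IH].
  rewrite big_nil (_ : (fun _ => _) = (fun x => 0 * (fun=> 0) x)).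
    by rewrite LclZ ?scale0r//; exact: inL_cst.
  by apply/funext => x; rewrite big_nil mul0r.
rewrite big_cons -IH -LclD//; last exact: inL_sum.
by congr Lcl; apply/funext => x; rewrite big_cons.
Qed.

Lemma LclB (f g : R -> R) : inL f -> inL g -> Lcl (fun x => f x - g x) = Lcl f - Lcl g.
Proof.
move=> hf hg; rewrite -[- Lcl g]scaleN1r -LclZ// -LclD//; last exact: inLZ.
by congr Lcl; apply/funext => x; rewrite mulN1r.
Qed.

Lemma inLB (f g : R -> R) : inL f -> inL g -> inL (fun x => f x - g x).
Proof.
move=> hf hg; have := inLD hf (inLZ (-1) hg).
by congr inL; apply/funext => x; rewrite mulN1r.
Qed.

Lemma measurable_normr_powR (f : T -> R) : measurable_fun setT f ->
  measurable_fun setT (fun x => (`|f x| `^ q)%:E).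
Proof.
move=> mf; apply/measurable_EFinP.
apply: (@measurableT_comp _ _ _ _ _ _ (fun x : R => x `^ q)).
  exact: measurable_powR.
exact: measurableT_comp.
Qed.

Lemma leb01_integral (f : R -> \bar R) : measurable_fun setT (f : T -> \bar R) ->
  (forall x, 0 <= f x)%E ->
  (\int[leb01 R]_x f x = \int[mu]_(x in `]0%R, 1%R[) f x)%E.
Proof.
move=> mf f0.
have mI : measurable (`]0, 1[%classic : set T) by exact: measurable_itv.
rewrite -(setUv (`]0, 1[%classic : set T)) ge0_integral_setU//=; last 3 first.
- exact: measurableC.
- by rewrite setUv.
- by rewrite disj_set2E setICr.
rewrite [X in (_ + X)%E](_ : _ = 0%E) ?adde0.
  apply: eq_measure_integral => A mA AI.
  by rewrite /= /mfrestr /mrestr setIidl.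
apply: null_set_integral => //.
- exact: measurableC.
- exact: measurable_funS mf.
- by rewrite /leb01/= /mfrestr /mrestr setICl measure0.
Qed.

Lemma powR_norm_Lcl (f : R -> R) : inL f ->
  ((`|Lcl f| `^ q)%:E = \int[mu]_(x in `]0%R, 1%R[) (`|f x| `^ q)%:E)%E.
Proof.
move=> hf; rewrite (Lcl_Sub hf) norm_Lclass.
have mf : measurable_fun setT (f : T -> R) by case/andP: hf => /set_mem.
have q0 : 0 < q by rewrite (lt_trans ltr01).
rewrite -poweR_EFin finite_norm_fine poweR_Lnorm ?gt_eqF//.
rewrite leb01_integral//=.
  exact: measurable_normr_powR.
Qed.

Lemma inL_measurable (f : R -> R) : inL f -> measurable_fun setT (f : T -> R).
Proof. by case/andP => /set_mem. Qed.

Lemma inL_integral (f : R -> R) : measurable_fun setT (f : T -> R) ->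
  (\int[mu]_(x in `]0%R, 1%R[) (`|f x| `^ q)%:E < +oo)%E -> inL f.
Proof.
move=> mf fi; have q0 : 0 < q by rewrite (lt_trans ltr01).
apply/andP; split; rewrite inE//= /finite_norm unlock /= poweR_lty//.
rewrite leb01_integral//=.
  exact: measurable_normr_powR.
Qed.

Let mI : measurable (`]0, 1[%classic : set T).
Proof. exact: measurable_itv. Qed.

Let muI : mu (`]0, 1[%classic : set T) = 1%E.
Proof. by rewrite lebesgue_measure_itv/= lte_fin ltr01 oppr0 adde0. Qed.

Lemma inL_bounded (f : R -> R) (M : R) : measurable_fun setT (f : T -> R) ->
  (forall x, 0 < x < 1 -> `|f x| <= M) -> inL f.
Proof.
move=> mf fM; have q0 : 0 < q by rewrite (lt_trans ltr01).
apply: inL_integral => //.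
apply: (@le_lt_trans _ _ (\int[mu]_(x in `]0%R, 1%R[) (`|M| `^ q)%:E)%E).
  apply: ge0_le_integral => //.
  - by apply: measurable_funTS; exact: measurable_normr_powR.
  - move=> x /=; rewrite in_itv/= => x01; rewrite lee_fin ge0_ler_powR ?nnegrE ?(ltW q0)//.
    by rewrite (le_trans (fM x x01))// ler_norm.
by rewrite integral_cst//= muI mule1 ltry.
Qed.

Lemma contf_measurable (f : R -> R) : contf f -> measurable_fun setT (f : T -> R).
Proof. exact: continuous_measurable_fun. Qed.

Lemma inL_contf (f : R -> R) : contf f -> inL f.
Proof.
move=> cf; have cc : compact (`[0, 1] : set R) by exact: segment_compact.
have cfW : {within `[0, 1], continuous f} by exact: continuous_subspaceT.
have [M [_ HM]] := compact_bounded (continuous_compact cfW cc).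
apply: (@inL_bounded _ (`|M| + 1)); first exact: contf_measurable.
move=> x /andP[x0 x1]; apply: (HM (`|M| + 1)).
  by rewrite (le_lt_trans (ler_norm M))// ltrDl.
by exists x => //=; rewrite in_itv/= !ltW.
Qed.

Lemma powR_norm_contf (f : R -> R) : contf f ->
  `|Lcl f| `^ q = \int[mu]_(x in `[0, 1]) (`|f x| `^ q).
Proof.
move=> cf; have q0 : 0 < q by rewrite (lt_trans ltr01).
have cfq : contf (fun x => `|f x| `^ q) by exact: contf_norm_powR.
have intf := @contf_integrable R _ 0 1 cfq.
apply: EFin_inj; rewrite powR_norm_Lcl; last exact: inL_contf.
rewrite /Rintegral fineK; last exact: integrable_fin_num.
rewrite [RHS]integral_itv_bndoo//; apply: measurable_funTS.
by apply: measurable_normr_powR; exact: contf_measurable.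
Qed.

Lemma powR_le_root (x y : R) : 0 <= x -> 0 <= y -> x `^ q <= y -> x <= y `^ q^-1.
Proof.
move=> x0 y0 xy; have q0 : 0 < q by rewrite (lt_trans ltr01).
have := @ge0_ler_powR _ q^-1 _ _ _ _ _ xy.
rewrite -powRrM mulfV ?gt_eqF// powRr1//; apply => //.
  by rewrite invr_ge0 ltW.
by rewrite nnegrE powR_ge0.
Qed.

(** A short support makes the norm small even when the supremum does not shrink. This is how
    difference quotients of Green functions, and steps close to 1, converge in the norm though not
    uniformly. *)
Lemma norm_Lcl_le (f : R -> R) (a b M : R) : inL f -> a <= b -> 0 <= M ->
  (forall x, 0 < x < 1 -> x \in `[a, b] -> `|f x| <= M) ->
  (forall x, 0 < x < 1 -> x \notin `[a, b] -> f x = 0) ->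
  `|Lcl f| <= M * (b - a) `^ q^-1.
Proof.
move=> hf ab M0 fM f0; have q0 : 0 < q by rewrite (lt_trans ltr01).
have ME : M * (b - a) `^ q^-1 = (M `^ q * (b - a)) `^ q^-1.
  by rewrite powRM ?powR_ge0 ?subr_ge0// -powRrM mulfV ?gt_eqF// powRr1.
rewrite ME; apply: powR_le_root => //; first by rewrite mulr_ge0 ?powR_ge0 ?subr_ge0.
have mf := inL_measurable hf.
have mab : measurable (`[a, b]%classic : set T) by exact: measurable_itv.
rewrite -lee_fin powR_norm_Lcl//.
apply: (@le_trans _ _ (\int[mu]_(x in `]0%R, 1%R[) ((M `^ q)%:E * (\1_(`[a, b]%classic : set T) x)%:E))%E).
  apply: ge0_le_integral => //.
  - by apply: measurable_funTS; exact: measurable_normr_powR.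
  - apply/measurable_EFinP; apply: measurable_funTS.
    exact: measurable_funM.
  - move=> x /=; rewrite in_itv/= => x01; rewrite -EFinM lee_fin indicE.
    have [xab|xab] := boolP (x \in `[a, b]).
      rewrite mem_set// mulr1 ge0_ler_powR ?nnegrE ?(ltW q0)//; exact: fM.
    by rewrite f0// normr0 powR0 ?gt_eqF// mulr_ge0// powR_ge0.
rewrite ge0_integralZl//; last 2 first.
- by apply/measurable_EFinP; exact: measurable_funTS.
- by rewrite lee_fin powR_ge0.
rewrite integral_indic// EFinM lee_wpmul2l ?lee_fin ?powR_ge0//.
apply: (@le_trans _ _ (mu (`[a, b]%classic : set T))).
  by apply: le_measure; rewrite ?inE//; exact: measurableI.
rewrite lebesgue_measure_itv/= lte_fin.
by case: ifP => _; rewrite -?EFinB lee_fin// subr_ge0.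
Qed.

Lemma norm_Lcl_sup (f : R -> R) (M : R) : inL f -> 0 <= M ->
  (forall x, 0 < x < 1 -> `|f x| <= M) -> `|Lcl f| <= M.
Proof.
move=> hf M0 fM; have := @norm_Lcl_le f 0 1 M hf ler01 M0 (fun x h _ => fM x h).
rewrite subr0 powR1 mulr1; apply => x /andP[x0 x1].
by rewrite in_itv/= !ltW.
Qed.

End Lclass_total.

(** * Integrals of even periodic functions under dilation *)

Section periodic_integrals.
Context (R : realType).
Local Notation mu := (@lebesgue_measure R).

Lemma Rintegral_affine (h : R -> R) (a b c d : R) : contf h -> 0 < c -> a <= b ->
  \int[mu]_(x in `[c * a + d, c * b + d]) h x = c * \int[mu]_(x in `[a, b]) h (c * x + d).
Proof.
move=> ch c0 ab; pose F (x : R) := c * x + d.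
have cF : contf F by rewrite /F; continuity.
have dF x : is_derive x (1 : R) F c.
  apply: (is_derive_eq (is_deriveD_fun (is_deriveM_fun (is_derive_cst_fun c x) (is_derive_id_fun x))
    (is_derive_cst_fun d x))); ring.
have F'E : F^`()%classic = cst c by apply/funext => x; rewrite derive1E; exact: derive_val.
have chF : contf (fun x => h (c * x + d)) by exact: (contf_comp ch cF).
rewrite -RintegralZl//; last exact: contf_integrable.
rewrite /Rintegral (@integration_by_substitution_increasing _ F h a b) //.
- by congr fine; apply: eq_integral => x _; rewrite !fctE F'E mulrC.
- by move=> x y _ _ xy; rewrite /F ltrD2r ltr_pM2l.
- by rewrite F'E => x _; exact: cvg_cst.
- by rewrite F'E; exact: is_cvg_cst.
- by rewrite F'E; exact: is_cvg_cst.
- split; first by move=> x _; exact: ex_derive.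
  + exact: cvg_at_right_filter (cF _).
  + exact: cvg_at_left_filter (cF _).
- exact: continuous_subspaceT.
Qed.

Lemma Rintegral_reflect (h : R -> R) : contf h ->
  \int[mu]_(x in `[0, 1]) h x = \int[mu]_(x in `[0, 1]) h (1 - x).
Proof.
move=> ch; rewrite Rintegration_by_substitution_onem ?ler01 ?lexx//.
  by rewrite /unstable.onem subrr.
exact: continuous_subspaceT.
Qed.

(** Every unit interval contributes the same, also for odd [k]: by evenness and period 2 the graph
    over [1, 2] mirrors the one over [0, 1], and further intervals are translates by multiples of
    2. *)
Lemma Rintegral_even_periodic (h : R -> R) (k : nat) : contf h ->
  (forall x, h (- x) = h x) -> (forall x, h (x + 2) = h x) ->
  \int[mu]_(x in `[0, k%:R]) h x = k%:R * \int[mu]_(x in `[0, 1]) h x.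
Proof.
move=> ch he hp.
have hshift (n : nat) : \int[mu]_(x in `[0, 1]) h (1 * x + n%:R) = \int[mu]_(x in `[0, 1]) h x.
  elim/ltn_ind: n => -[_|[_|n IH]].
  - by apply: eq_Rintegral => x _; rewrite mul1r addr0.
  - have cs : contf (fun x : R => h (1 * x + 1)).
      by apply: (contf_comp ch); continuity.
    rewrite (Rintegral_reflect cs); apply: eq_Rintegral => x _.
    by rewrite mul1r (_ : 1 - x + 1 = - x + 2) ?hp ?he//; ring.
  - rewrite -[RHS](IH n (ltnW (ltnSn n.+1))); apply: eq_Rintegral => x _.
    by rewrite -[RHS]hp -addrA -natrD addn2.
elim: k => [|k IH]; first by rewrite mul0r set_itv1 Rintegral_set1.
have ki : mu.-integrable `[0, k.+1%:R] (EFin \o h) by exact: contf_integrable.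
have := @Rintegral_itvB R h (BLeft 0) (BRight k.+1%:R) k%:R ki.
rewrite !bnd_simp ler0n ler_nat leqnSn => /(_ isT isT) /eqP.
rewrite Rintegral_itv_obnd_cbnd; last first.
  by apply: integrableS (@contf_integrable R h k%:R k.+1%:R ch) => //; exact: subset_itv_oc_cc.
rewrite subr_eq IH => /eqP ->.
have := @Rintegral_affine h 0 1 1 k%:R ch ltr01 ler01.
by rewrite mulr0 add0r !mul1r hshift -natr1 (addrC 1) => ->; rewrite addrC mulrDl mul1r.
Qed.

Lemma Rintegral_dilation (h : R -> R) (k : nat) : (0 < k)%N -> contf h ->
  (forall x, h (- x) = h x) -> (forall x, h (x + 2) = h x) ->
  \int[mu]_(x in `[0, 1]) h (k%:R * x) = \int[mu]_(x in `[0, 1]) h x.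
Proof.
move=> k0 ch he hp; have k0' : 0 < k%:R :> R by rewrite ltr0n.
have := @Rintegral_affine h 0 1 k%:R 0 ch k0' ler01.
rewrite mulr0 mulr1 !addr0 Rintegral_even_periodic//.
move=> /(mulfI (lt0r_neq0 k0')) ->.
by apply: eq_Rintegral => x _; rewrite addr0.
Qed.

End periodic_integrals.

Section sine_basis_bounds.
Context (R : realType) (q : R) (q1 : 1 < q).
Local Notation mu := (@lebesgue_measure R).

Let q0 : 0 < q. Proof. by rewrite (lt_trans ltr01). Qed.

Definition sine (k : nat) : L01 q1 := Lcl q1 (fun x => sin (k%:R * pi * x)).

Lemma sinesumN (a : nat -> R) N x : sinesum a N (- x) = - sinesum a N x.
Proof.
by rewrite /sinesum -sumrN; apply: eq_bigr => n _; rewrite mulrN sinN mulrN.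
Qed.

Lemma sin_nat_pi_periodic (k : nat) (x : R) : sin (k%:R * pi * (x + 2)) = sin (k%:R * pi * x).
Proof.
rewrite mulrDr (_ : k%:R * pi * 2 = k%:R * (2 * pi)); last by ring.
by have [hc hs] := cos_sin_nat2pi R k; rewrite sinD hc hs mulr1 mulr0 addr0.
Qed.

Lemma sinesum_periodic (a : nat -> R) N x : sinesum a N (x + 2) = sinesum a N x.
Proof. by apply: eq_bigr => n _; rewrite sin_nat_pi_periodic. Qed.

Lemma sum_sine (a : nat -> R) (N k : nat) :
  \sum_(n < N) a n *: sine (k * n.+1) = Lcl q1 (fun x => sinesum a N (k%:R * x)).
Proof.
rewrite /sinesum Lcl_sum; last first.
  by move=> n; apply: (inL_contf q1); continuity.
apply: eq_bigr => n _; rewrite LclZ; last first.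
  by apply: (inL_contf q1); continuity.
by congr (_ *: Lcl _ _); apply/funext => x; congr sin; rewrite natrM; ring.
Qed.

Lemma norm_sum_sine (a : nat -> R) (N k : nat) : (0 < k)%N ->
  `|\sum_(n < N) a n *: sine (k * n.+1)| `^ q =
  \int[mu]_(x in `[0, 1]) (`|sinesum a N x| `^ q).
Proof.
move=> k0; rewrite sum_sine powR_norm_contf; last first.
  have cl : contf (fun x : R => k%:R * x) by continuity.
  exact: (contf_comp (@contf_sinesum _ a N) cl).
apply: (@Rintegral_dilation R (fun x => `|sinesum a N x| `^ q) k k0).
- by apply: contf_norm_powR => //; exact: contf_sinesum.
- by move=> x; rewrite sinesumN normrN.
- by move=> x; rewrite sinesum_periodic.
Qed.

Lemma norm_sum_sine1 (a : nat -> R) (N : nat) :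
  `|\sum_(n < N) a n *: sine n.+1| `^ q = \int[mu]_(x in `[0, 1]) (`|sinesum a N x| `^ q).
Proof.
have E : \sum_(n < N) a n *: sine (1 * n.+1) = \sum_(n < N) a n *: sine n.+1.
  by apply: eq_bigr => n _; rewrite mul1n.
by rewrite -E (norm_sum_sine a N (ltn0Sn 0)).
Qed.

Lemma powR_inj_ge0 (x y : R) : 0 <= x -> 0 <= y -> x `^ q = y `^ q -> x = y.
Proof. by move=> x0 y0; apply: (powR_injective q0). Qed.

Lemma sine_dilation (a : nat -> R) (N k : nat) : (0 < k)%N ->
  `|\sum_(n < N) a n *: sine (k * n.+1)| = `|\sum_(n < N) a n *: sine n.+1|.
Proof.
move=> k0; apply: powR_inj_ge0; [exact: normr_ge0|exact: normr_ge0|].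
by rewrite (norm_sum_sine a N k0) norm_sum_sine1.
Qed.

Lemma sine_grunblum : exists K : R, forall (a : nat -> R) (m N : nat), (m <= N)%N ->
  `|\sum_(n < m) a n *: sine n.+1| <= K * `|\sum_(n < N) a n *: sine n.+1|.
Proof.
have [C C0 HC] := conjugate_bound q1.
exists ((2 `^ q * (2 * C)) `^ q^-1) => a m N mN.
have K0 : 0 <= 2 `^ q * (2 * C) by rewrite !mulr_ge0// powR_ge0.
(* The conjugation estimate lives on the full period [0, 4], the norm on (0, 1). *)
have four (b : nat -> R) M : \int[mu]_(x in `[0, 4]) (`|sinesum b M x| `^ q) =
    4 * `|\sum_(n < M) b n *: sine n.+1| `^ q.
  rewrite norm_sum_sine1 (@Rintegral_even_periodic R (fun x => `|sinesum b M x| `^ q) 4)//.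
  - by apply: contf_norm_powR => //; exact: contf_sinesum.
  - by move=> x; rewrite sinesumN normrN.
  - by move=> x; rewrite sinesum_periodic.
have := sine_partial_bound a q1 C0 mN HC.
rewrite !four mulrCA ler_pM2l//.
move: (normr_ge0 (\sum_(n < m) a n *: sine n.+1)) (normr_ge0 (\sum_(n < N) a n *: sine n.+1)).
move: `|_| `|_| => Y X X0 Y0 XY.
have KY0 : 0 <= 2 `^ q * (2 * C) * Y `^ q by rewrite mulr_ge0// powR_ge0.
have := powR_le_root q1 X0 KY0 XY.
by rewrite powRM ?powR_ge0// -powRrM mulfV ?gt_eqF// powRr1.
Qed.

End sine_basis_bounds.

(** * Bases in normed spaces *)

Section schauder_criteria.
Context (R : realType) (V : normedModType R).
Implicit Types (phi e s : nat -> V) (a : nat -> R).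

Definition in_closed_span phi (x : V) :=
  forall d, 0 < d -> exists N a, `|x - \sum_(n < N) a n *: phi n| < d.

Lemma lin_comb_widen phi a (N M : nat) : (N <= M)%N ->
  \sum_(n < N) a n *: phi n = \sum_(n < M) (if (n < N)%N then a n else 0) *: phi n.
Proof.
move=> NM; rewrite (big_ord_widen M (fun n => a n *: phi n) NM) big_mkcond/=.
by apply: eq_bigr => n _; case: ifP => //; rewrite scale0r.
Qed.

Lemma in_closed_spanD phi x y :
  in_closed_span phi x -> in_closed_span phi y -> in_closed_span phi (x + y).
Proof.
move=> hx hy d d0; have d2 : 0 < d / 2 by rewrite divr_gt0.
have [N [a ha]] := hx _ d2; have [M [b hb]] := hy _ d2.
exists (maxn N M), (fun n => (if (n < N)%N then a n else 0) + (if (n < M)%N then b n else 0)).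
under eq_bigr do rewrite scalerDl.
rewrite big_split/= -!lin_comb_widen ?leq_maxl ?leq_maxr// opprD addrACA.
by rewrite (le_lt_trans (ler_normD _ _))// (splitr d) ltrD.
Qed.

Lemma in_closed_spanZ phi (c : R) x : in_closed_span phi x -> in_closed_span phi (c *: x).
Proof.
move=> hx d d0; have c1 : 0 < `|c| + 1 by rewrite ltr_wpDl.
have [N [a ha]] := hx _ (divr_gt0 d0 c1).
exists N, (fun n => c * a n); under eq_bigr do rewrite -scalerA.
rewrite -scaler_sumr -scalerBr normrZ.
rewrite (@le_lt_trans _ _ ((`|c| + 1) * `|x - \sum_(n < N) a n *: phi n|))//.
  by rewrite ler_wpM2r// lerDl.
by rewrite mulrC -ltr_pdivlMr.
Qed.

Lemma in_closed_span_sum phi (I : Type) (r : seq I) (f : I -> V) :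
  (forall i, in_closed_span phi (f i)) -> in_closed_span phi (\sum_(i <- r) f i).
Proof.
move=> hf; elim: r => [|i r IH]; last by rewrite big_cons; exact: in_closed_spanD.
rewrite big_nil => d d0; exists 0, (fun=> 0).
by rewrite big_ord0 subrr normr0.
Qed.

Lemma in_closed_span_closed phi x :
  (forall d, 0 < d -> exists2 y, in_closed_span phi y & `|x - y| < d) -> in_closed_span phi x.
Proof.
move=> hx d d0; have d2 : 0 < d / 2 by rewrite divr_gt0.
have [y hy xy] := hx _ d2; have [N [a ha]] := hy _ d2; exists N, a.
rewrite -[x - _](subrKA y) (le_lt_trans (ler_normD _ _))// (splitr d) ltrD//.
Qed.

Lemma in_closed_span_mem phi n : in_closed_span phi (phi n).
Proof.
move=> d d0; exists n.+1, (fun i => (i == n)%:R).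
rewrite big_ord_recr/= eqxx scale1r big1 ?add0r ?subrr ?normr0// => i _.
by rewrite ltn_eqF ?scale0r.
Qed.

Lemma in_closed_span_trans phi e x : (forall n, in_closed_span phi (e n)) ->
  in_closed_span e x -> in_closed_span phi x.
Proof.
move=> he hx; apply: in_closed_span_closed => d d0.
have [N [a ha]] := hx d d0; exists (\sum_(n < N) a n *: e n) => //.
by apply: in_closed_span_sum => n; exact: in_closed_spanZ.
Qed.

Section grunblum.
Variables (phi : nat -> V) (K : R).
Hypothesis phi0 : forall n, phi n != 0.
Hypothesis HK : forall a (m N : nat), (m <= N)%N ->
  `|\sum_(n < m) a n *: phi n| <= K * `|\sum_(n < N) a n *: phi n|.

Let S a N := \sum_(n < N) a n *: phi n.

Let K0 : 0 <= K.
Proof.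
have := @HK (fun=> 1) 1 1 (leqnn _); rewrite big_ord1 scale1r.
by rewrite -{1}[`|phi 0|]mul1r ler_pM2r ?normr_gt0// => /(le_trans ler01).
Qed.

(** A term is the difference of two consecutive partial sums, so the coefficient functionals are
    bounded on finite sums. Uniqueness of expansions follows. *)
Let coef_le a n N : (n < N)%N -> `|a n| * `|phi n| <= 2 * K * `|S a N|.
Proof.
move=> nN; rewrite -normrZ.
have -> : a n *: phi n = S a n.+1 - S a n by rewrite /S big_ord_recr/= [RHS]addrC addKr.
rewrite (le_trans (ler_normB _ _))// mulrAC -mulrA mulr_natl mulr2n mulrC lerD//.
  exact: HK.
by apply: HK; exact: ltnW.
Qed.

Let SB a b N : S (fun n => a n - b n) N = S a N - S b N.
Proof. by rewrite /S -sumrB; apply: eq_bigr => n _; rewrite scalerBl. Qed.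

Lemma grunblum_unique (a b : nat -> R) (x : V) :
  series (fun n => a n *: phi n) @ \oo --> x ->
  series (fun n => b n *: phi n) @ \oo --> x -> a = b.
Proof.
have sE c : series (fun n => c n *: phi n) = S c.
  by apply/funext => N; rewrite /series/= big_mkord.
rewrite !sE => ha hb; apply/funext => n; apply/eqP; rewrite -subr_eq0 -normr_le0.
rewrite -(pmulr_lle0 _ (_ : 0 < `|phi n|)) ?normr_gt0//.
have hab : S (fun n => a n - b n) @ \oo --> (0 : V).
  rewrite -(subrr x) (_ : S _ = S a - S b); last by apply/funext => N; rewrite SB.
  exact: cvgB.
have h2 : (fun N => 2 * K * `|S (fun n => a n - b n) N|) @ \oo --> (0 : R).
  rewrite -(mulr0 (2 * K)); apply: cvgM; first exact: cvg_cst.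
  by rewrite -(normr0 V); exact: cvg_norm.
rewrite -(cvg_lim (@Rhausdorff R) h2); apply: limr_ge.
  by apply/cvg_ex; exists 0.
by near=> N; apply: (coef_le (fun n => a n - b n)); near: N; exact: nbhs_infty_gt.
Unshelve. all: by end_near. Qed.

(** Finite sums approximating [x] have convergent coefficients, and their partial sums of any length
    [N] are close to those of the limit sequence, uniformly in [N]. For large [N] such a partial sum
    is the whole approximant, which is close to [x]. *)
Lemma grunblum_exists (x : V) : in_closed_span phi x ->
  exists a : nat -> R, series (fun n => a n *: phi n) @ \oo --> x.
Proof.
move=> hx.
have /choice[Nb Hb] : forall k : nat, exists p : nat * (nat -> R),
    `|x - S p.2 p.1| < k.+1%:R^-1.
  by move=> k; have [N [a ha]] := hx k.+1%:R^-1 (ltac:(by rewrite invr_gt0)); exists (N, a).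
(* Padding by zeros allows approximants of different lengths to be subtracted. *)
pose b k n := if (n < (Nb k).1)%N then (Nb k).2 n else 0.
have Sb k N : ((Nb k).1 <= N)%N -> S (b k) N = S (Nb k).2 (Nb k).1.
  by move=> kN; rewrite /S [RHS](lin_comb_widen _ _ kN).
(* Independent of [N]: the Grunblum inequality passes from [N] to a length [M] at which both sums
   are complete and close to [x]. *)
have diff k l N : `|S (b k) N - S (b l) N| <= K * (k.+1%:R^-1 + l.+1%:R^-1).
  rewrite -SB; set M := maxn N (maxn (Nb k).1 (Nb l).1).
  have NM : (N <= M)%N by exact: leq_maxl.
  apply: (le_trans (HK _ NM)); rewrite ler_wpM2l//.
  rewrite [X in `|X|](SB (b k) (b l) M) !Sb; last 2 first.
  - by rewrite /M !leq_max leqnn !orbT.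
  - by rewrite /M !leq_max leqnn !orbT.
  rewrite -(subrKA x) (le_trans (ler_normD _ _))// lerD//; first by rewrite distrC ltW.
  by rewrite ltW.
have bdiff n k l : `|b k n - b l n| <= 2 * K * (k.+1%:R^-1 + l.+1%:R^-1) / `|phi n|.
  rewrite ler_pdivlMr ?normr_gt0//.
  have -> : `|b k n - b l n| * `|phi n| = `|(S (b k) n.+1 - S (b l) n.+1) - (S (b k) n - S (b l) n)|.
    rewrite -normrZ scalerBl; congr `|_|; rewrite /S !big_ord_recr/=.
    by rewrite opprD addrACA [RHS]addrC addKr.
  rewrite (le_trans (ler_normB _ _))// -mulrA mulr_natl mulr2n lerD//.
have small (c e : R) : 0 <= c -> 0 < e -> exists k : nat, c / k.+1%:R < e.
  move=> c0 e0; have [k _ hk] := near_infty_natSinv_lt (PosNum (divr_gt0 e0 (ltr_wpDl c0 ltr01))).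
  exists k; have := hk k (leqnn k); rewrite /= ltr_pdivlMr ?ltr_wpDl// => h.
  rewrite (le_lt_trans _ h)// mulrC ler_wpM2l ?invr_ge0//.
  by rewrite lerDl.
have inv_le (k l : nat) : (k <= l)%N -> l.+1%:R^-1 <= k.+1%:R^-1 :> R.
  by move=> kl; rewrite lef_pV2 ?posrE// ler_nat.
have bcvg n : cvgn (fun k => b k n).
  apply/cauchy_cvgP/cauchy_exP => e /= e0.
  have [|k hk] := small (4 * K / `|phi n|) e _ e0; first by rewrite divr_ge0// mulr_ge0.
  exists (b k n); exists k => // l /= kl; rewrite /ball/=.
  rewrite (le_lt_trans (bdiff n k l))// (le_lt_trans _ hk)//.
  rewrite [leRHS]mulrAC ler_wpM2r ?invr_ge0//.
  have -> : 4 * K = 2 * K * 2 :> R by ring.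
  by rewrite -[leRHS]mulrA ler_wpM2l ?mulr_ge0// mulr_natl mulr2n lerD2l inv_le.
pose a n := limn (fun k => b k n).
have Scvg N : (fun l => S (b l) N) @ \oo --> S a N.
  elim: N => [|N IH].
    rewrite (_ : (fun _ => _) = (fun=> S a 0)); first exact: cvg_cst.
    by apply/funext => l; rewrite /S !big_ord0.
  rewrite (_ : (fun _ => _) = (fun l => S (b l) N + b l N *: phi N)); last first.
    by apply/funext => l; rewrite /S big_ord_recr.
  rewrite (_ : S a N.+1 = S a N + a N *: phi N); last by rewrite /S big_ord_recr.
  by apply: cvgD => //; apply: cvgZr_tmp; exact: bcvg.
(* Letting [l] tend to infinity in [diff] keeps the uniformity in [N]. *)
have Sa k N : `|S (b k) N - S a N| <= 2 * K / k.+1%:R.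
  have h : (fun l => `|S (b k) N - S (b l) N|) @ \oo --> `|S (b k) N - S a N|.
    by apply: cvg_norm; apply: cvgB => //; exact: cvg_cst.
  rewrite -(cvg_lim (@Rhausdorff R) h); apply: limr_le.
    by apply/cvg_ex; exists (`|S (b k) N - S a N|).
  near=> l; rewrite (le_trans (diff k l N))// [2 * K]mulrC -mulrA ler_wpM2l// mulr_natl mulr2n lerD2l.
  by apply: inv_le; near: l; exact: nbhs_infty_ge.
exists a; apply/cvgrPdist_lt => e e0.
have [|k hk] := small (1 + 2 * K) e _ e0; first by rewrite addr_ge0// mulr_ge0.
exists (Nb k).1 => // N /= hN; rewrite /series/= big_mkord -/(S a N).
rewrite -(subrKA (S (b k) N)) (le_lt_trans (ler_normD _ _))// (le_lt_trans _ hk)//.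
rewrite mulrDl mul1r lerD// Sb//; exact: ltW.
Unshelve. all: by end_near. Qed.

Lemma grunblum_basis : (forall x, in_closed_span phi x) -> schauder_basis phi.
Proof.
move=> hd x; have [a ha] := grunblum_exists (hd x); exists a; split => // b hb.
exact: grunblum_unique ha hb.
Qed.

End grunblum.
End schauder_criteria.

(** * Perturbation of a basis by its dilations *)

Section dilation_perturbation.
Context (R : realType) (V : normedModType R).
Variables (e s : nat -> V) (c : nat -> R) (K : R).
Hypothesis e1 : e 1 != 0.
Hypothesis dilation : forall (a : nat -> R) (N k : nat), (0 < k)%N ->
  `|\sum_(n < N) a n *: e (k * n.+1)| = `|\sum_(n < N) a n *: e n.+1|.
Hypothesis expansion : forall n,
  (fun J => \sum_(j < J) c j *: e (j.+1 * n.+1)) @ \oo --> s n.+1.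
Hypothesis c0 : 0 < c 0.
Hypothesis cle : forall j, `|c j| <= c 0 / (j.+1%:R ^+ 2).
Hypothesis HK : forall (a : nat -> R) (m N : nat), (m <= N)%N ->
  `|\sum_(n < m) a n *: e n.+1| <= K * `|\sum_(n < N) a n *: e n.+1|.

(** The first term 1/4 is kept and the rest telescopes through 1/(x+1)^2 <= 1/x - 1/(x+1), for a
    total of 1/4 + 1/2. Telescoping from the first term on would only give 1, too much for the
    perturbation. *)
Lemma sum_inv_sqr_le (J : nat) : \sum_(j < J) (j.+2%:R ^+ 2)^-1 <= 3 / 4 :> R.
Proof.
case: J => [|J]; first by rewrite big_ord0; lra.
suff : \sum_(j < J.+1) (j.+2%:R ^+ 2)^-1 <= 3 / 4 - J.+2%:R^-1 :> R.
  by move=> h; rewrite (le_trans h)// gerBl invr_ge0.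
elim: J => [|J IH].
  by rewrite big_ord_recr big_ord0/=; lra.
rewrite big_ord_recr/= (le_trans (lerD IH (lexx _)))//.
rewrite -(natr1 J.+2); set x := J.+2%:R : R.
have x0 : 0 < x by rewrite ltr0n.
have : ((x + 1) ^+ 2)^-1 <= x^-1 - (x + 1)^-1.
  have -> : x^-1 - (x + 1)^-1 = (x * (x + 1))^-1 by field; rewrite !gt_eqF//; lra.
  rewrite lef_pV2 ?posrE ?exprn_gt0 ?mulr_gt0//; nra.
by move: ((x + 1) ^+ 2)^-1 x^-1 (x + 1)^-1 => ? ? ?; lra.
Qed.

Let tail_le (f : nat -> R) (b : R) (J : nat) : 0 <= b -> (forall j, `|f j| <= b) ->
  \sum_(j < J) `|c j.+1| * `|f j| <= 3 / 4 * c 0 * b.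
Proof.
move=> b0 fb; rewrite (@le_trans _ _ (\sum_(j < J) (j.+2%:R ^+ 2)^-1 * (c 0 * b)))//.
  apply: ler_sum => j _; rewrite mulrA; apply: ler_pM => //.
  by rewrite mulrC; exact: cle.
by rewrite -mulr_suml -mulrA ler_wpM2r ?sum_inv_sqr_le// mulr_ge0// ltW.
Qed.

Let F (a : nat -> R) (N : nat) : V := \sum_(n < N) a n *: e n.+1.
Let G (a : nat -> R) (N : nat) : V := \sum_(n < N) a n *: s n.+1.

Lemma perturbation_le a N : `|G a N - c 0 *: F a N| <= 3 / 4 * c 0 * `|F a N|.
Proof.
(* Truncating the expansions of the [s n.+1] makes the exchange of sums finite; [J.+1] terms ensure
   that the leading one can be split off. *)
pose H J := \sum_(n < N) a n *: (\sum_(j < J.+1) c j *: e (j.+1 * n.+1)).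
have HE J : H J = c 0 *: F a N + \sum_(j < J) c j.+1 *: (\sum_(n < N) a n *: e (j.+2 * n.+1)).
  rewrite /H; under eq_bigr do rewrite big_ord_recl scalerDr scaler_sumr.
  rewrite big_split/=; congr (_ + _).
    rewrite /F scaler_sumr; apply: eq_bigr => n _.
    by rewrite mul1n !scalerA mulrC.
  rewrite exchange_big/=; apply: eq_bigr => j _; rewrite scaler_sumr.
  by apply: eq_bigr => n _; rewrite !scalerA mulrC.
have Hcvg : H @ \oo --> G a N.
  rewrite /H /G; elim: (N) => [|M IH].
    rewrite big_ord0 (_ : (fun _ => _) = (fun=> 0)); first exact: cvg_cst.
    by apply/funext => J; rewrite big_ord0.
  rewrite big_ord_recr/= (_ : (fun _ => _) =
     (fun J => \sum_(n < M) a n *: (\sum_(j < J.+1) c j *: e (j.+1 * n.+1))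
             + a M *: (\sum_(j < J.+1) c j *: e (j.+1 * M.+1)))); last first.
    by apply/funext => J; rewrite big_ord_recr.
  apply: cvgD => //; apply: cvgZl_tmp.
  have := @expansion M; rewrite -(cvg_shiftS (fun J => \sum_(j < J) c j *: e (j.+1 * M.+1))).
  exact.
have Ncvg : (fun J => `|H J - c 0 *: F a N|) @ \oo --> `|G a N - c 0 *: F a N|.
  by apply: cvg_norm; apply: cvgB => //; exact: cvg_cst.
rewrite -(cvg_lim (@Rhausdorff R) Ncvg); apply: limr_le.
  by apply/cvg_ex; exists `|G a N - c 0 *: F a N|.
apply: nearW => J; rewrite HE addrC addKr (le_trans (ler_norm_sum _ _ _))//.
under eq_bigr do rewrite normrZ dilation// -/(F a N).
rewrite (le_trans _ (@tail_le (fun=> `|F a N|) `|F a N| J _ _))// => [|j]; last by rewrite normr_id.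
by apply: ler_sum => j _; rewrite normr_id.
Qed.

Let G_upper a N : `|G a N| <= 7 / 4 * c 0 * `|F a N|.
Proof.
rewrite -[G a N](subrK (c 0 *: F a N)) (le_trans (ler_normD _ _))//.
have := perturbation_le a N; rewrite normrZ gtr0_norm//; lra.
Qed.

(** The factor 4 is 1 / (1 - 3/4). Together with [G_upper] it makes sums with the same coefficients
    comparable in the two systems. *)
Let F_upper a N : c 0 * `|F a N| <= 4 * `|G a N|.
Proof.
have := perturbation_le a N; have := ler_normD (c 0 *: F a N - G a N) (G a N).
rewrite subrK [`|c 0 *: F a N - _|]distrC normrZ gtr0_norm//; lra.
Qed.

Let norm_e n : `|e n.+1| = `|e 1|.
Proof.
have := @dilation (fun=> 1) 1 n.+1 (ltn0Sn n).
by rewrite !big_ord1 !scale1r muln1.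
Qed.

Lemma perturbed_neq0 n : s n.+1 != 0.
Proof.
pose a (i : nat) : R := (i == n)%:R.
have single (f : nat -> V) : \sum_(i < n.+1) a i *: f i = f n.
  rewrite big_ord_recr/= /a eqxx scale1r big1 ?add0r// => i _.
  by rewrite ltn_eqF ?scale0r.
have := F_upper a n.+1; rewrite /F /G (single (fun i => e i.+1)) (single (fun i => s i.+1)) norm_e.
apply: contraTneq => ->; rewrite normr0 mulr0 -ltNge mulr_gt0// normr_gt0//.
Qed.

(** The inequality is transported through the comparison of norms, whence 7 = 7/4 times 4. *)
Lemma perturbed_grunblum (a : nat -> R) (m N : nat) : (m <= N)%N ->
  `|\sum_(n < m) a n *: s n.+1| <= (7 * K) * `|\sum_(n < N) a n *: s n.+1|.
Proof.
move=> mN; have K0 : 0 <= K.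
  have := @HK (fun=> 1) 1 1 (leqnn _); rewrite big_ord1 scale1r.
  by rewrite -{1}[`|e 1|]mul1r ler_pM2r ?normr_gt0// => /(le_trans ler01).
apply: (le_trans (G_upper a m)).
have h1 := @HK a m N mN; have h2 := ler_wpM2l K0 (F_upper a N).
have h3 : c 0 * `|F a m| <= c 0 * (K * `|F a N|) by rewrite ler_wpM2l// ltW.
rewrite -/(G a N); nra.
Qed.

(** The bound is uniform in [n] because improving the approximation of one vector uses those of all
    its dilations. *)
Let approx (b : R) := forall n, exists2 y, in_closed_span (fun n => s n.+1) y & `|e n.+1 - y| <= b.

(** Solving the expansion of [s n.+1] for its leading term expresses [e n.+1] through [s n.+1] and
    the dilated vectors, for which the given approximants are substituted. Their errors sum to at
    most 3/4 of [b], and truncation costs 1/8. *)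
Let approx_step b : 0 < b -> approx b -> approx (7 / 8 * b).
Proof.
move=> b0 hb n; have [y hy ey] : exists2 y : nat -> V,
    (forall j, in_closed_span (fun n => s n.+1) (y j)) & (forall j, `|e (j.+2 * n.+1) - y j| <= b).
  suff /choice[y Hy] : forall j : nat, exists z : V,
      in_closed_span (fun n => s n.+1) z /\ `|e (j.+2 * n.+1) - z| <= b.
    by exists y => j; have [] := Hy j.
  by move=> j; have [z z1 z2] := hb (j.+2 * n.+1).-1; exists z.
(* Tolerance for the tail of the expansion; it becomes [b / 8] after division by [c 0]. *)
have cb : 0 < c 0 * b / 8 by rewrite divr_gt0// mulr_gt0.
have /cvgrPdist_le/(_ _ cb)[J0 _ hJ] := @expansion n.
have {hJ} := hJ J0.+1 (leqnSn J0) => /= hJ.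
pose z := (c 0)^-1 *: (s n.+1 - \sum_(j < J0) c j.+1 *: y j).
exists z.
  apply: in_closed_spanZ; apply: in_closed_spanD.
    exact: (in_closed_span_mem (fun n => s n.+1)).
  rewrite -scaleN1r; apply: in_closed_spanZ; apply: in_closed_span_sum => j.
  exact: in_closed_spanZ.
rewrite -(ler_pM2l c0) -{1}[c 0](gtr0_norm c0) -normrZ scalerBr /z scalerA divff ?gt_eqF// scale1r.
rewrite big_ord_recl/= mul1n in hJ.
set A := \sum_(j < J0) c j.+1 *: y j; rewrite distrC.
have -> : s n.+1 - A - c 0 *: e n.+1 =
    (s n.+1 - (c 0 *: e n.+1 + \sum_(j < J0) c j.+1 *: e (j.+2 * n.+1))) +
    \sum_(j < J0) c j.+1 *: (e (j.+2 * n.+1) - y j).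
  rewrite [X in _ = _ + X](eq_bigr _ (fun j _ => scalerBr _ _ _)).
  by rewrite sumrB -/A opprD !addrA subrK addrAC.
rewrite (le_trans (ler_normD _ _))// (le_trans (lerD hJ (ler_norm_sum _ _ _)))//.
have := @tail_le (fun j => `|e (j.+2 * n.+1) - y j|) b J0 (ltW b0).
under eq_bigr do rewrite normr_id -normrZ.
have ey' j : `| `|e (j.+2 * n.+1) - y j| | <= b by rewrite normr_id.
move=> /(_ ey') h.
by rewrite (le_trans (lerD (lexx _) h))//; lra.
Qed.

Lemma unperturbed_in_span n : in_closed_span (fun n => s n.+1) (e n.+1).
Proof.
have it k : approx ((7 / 8) ^+ k * `|e 1|).
  elim: k => [|k IH].
    move=> m; exists 0; last by rewrite subr0 expr0 mul1r norm_e.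
    by rewrite -(scale0r (s 1)); apply: in_closed_spanZ; exact: (in_closed_span_mem (fun n => s n.+1) 0).
  by rewrite exprS -mulrA; apply: approx_step => //; rewrite mulr_gt0 ?exprn_gt0 ?normr_gt0.
apply: in_closed_span_closed => d d0.
have h : (fun k => (7 / 8) ^+ k * `|e 1|) @ \oo --> (0 : R).
  by rewrite -(mul0r `|e 1|); apply: cvgM; [apply: cvg_expr; rewrite gtr0_norm; lra|exact: cvg_cst].
have /cvgrPdist_lt/(_ d d0)[k _ hk] := h.
have := hk k (leqnn k); rewrite /= sub0r normrN ger0_norm ?mulr_ge0 ?exprn_ge0// => {}hk.
by have [y y1 y2] := it k n; exists y => //; exact: le_lt_trans y2 hk.
Qed.

Lemma perturbed_basis : (forall x, in_closed_span (fun n => e n.+1) x) ->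
  schauder_basis (fun n => s n.+1).
Proof.
move=> hd; apply: (@grunblum_basis _ _ _ (7 * K)).
- exact: perturbed_neq0.
- exact: perturbed_grunblum.
- by move=> x; apply: in_closed_span_trans (hd x) => n; exact: unperturbed_in_span.
Qed.

End dilation_perturbation.

(** * Fourier series of the Green functions and of the triangular wave *)

Section green_series.
Context (R : realType).

Lemma mean_value_bound (f df : R -> R) (a b C : R) : a <= b ->
  (forall y, a <= y <= b -> is_derive y (1 : R) f (df y)) ->
  (forall y, a <= y <= b -> `|df y| <= C) -> `|f b - f a| <= C * (b - a).
Proof.
rewrite le_eqVlt => /predU1P[-> _ _|ab fdf dfC]; first by rewrite !subrr normr0 mulr0.
have fdf' y : y \in `]a, b[ -> is_derive y (1 : R) f (df y).
  by rewrite in_itv/= => /andP[ay yb]; apply: fdf; rewrite !ltW.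
have [|y] := MVT ab fdf'.
  apply: derivable_within_continuous => y; rewrite in_itv/= => yab.
  exact: (@ex_derive _ _ _ _ _ _ _ (fdf y yab)).
rewrite in_itv/= => /andP[ay yb] ->; rewrite normrM [`|b - a|]gtr0_norm ?subr_gt0//.
by rewrite ler_wpM2r ?subr_ge0 ?(ltW ab)// dfC// !ltW.
Qed.

Lemma sin_nat_pi n : sin (n%:R * pi) = 0 :> R.
Proof.
elim: n => [|n IH]; first by rewrite mul0r sin0.
by rewrite -natr1 mulrDl mul1r sinDpi IH oppr0.
Qed.

(** The derivative of [cos2sum] is [- sin1sum], and that of [sin1sum] is the Dirichlet kernel
    [cos0sum]. On (0, pi] the limit of [sin1sum] is (pi - x)/2, so the increment of [cos2sum] from x
    to pi tends to -(x - pi)^2 / 4. *)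
Definition cos2sum (N : nat) (x : R) := \sum_(n < N) cos (n.+1%:R * x) * (n.+1%:R ^+ 2)^-1.
Definition sin1sum (N : nat) (x : R) := \sum_(n < N) sin (n.+1%:R * x) * n.+1%:R^-1.
Definition cos0sum (N : nat) (x : R) := \sum_(n < N) cos (n.+1%:R * x).

Lemma is_derive_cos2sum N x : is_derive x (1 : R) (cos2sum N) (- sin1sum N x).
Proof.
rewrite /sin1sum -sumrN; apply: is_derive_sum_fun => n.
have hc := @is_derive_scale R cos (fun y => - sin y) n.+1%:R x (fun y => is_derive_cos y).
eapply is_derive_eq; first by derive_fun.
have : n.+1%:R != 0 :> R by rewrite pnatr_eq0.
by rewrite /=; move: (n.+1%:R : R) => m m0; field.
Qed.

Lemma is_derive_sin1sum N x : is_derive x (1 : R) (sin1sum N) (cos0sum N x).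
Proof.
apply: is_derive_sum_fun => n.
have hs := @is_derive_scale R sin cos n.+1%:R x (fun y => is_derive_sin y).
eapply is_derive_eq; first by derive_fun.
have : n.+1%:R != 0 :> R by rewrite pnatr_eq0.
by rewrite /=; move: (n.+1%:R : R) => m m0; field.
Qed.

Lemma dirichlet_kernel N x :
  2 * sin (2^-1 * x) * cos0sum N x = sin ((N%:R + 2^-1) * x) - sin (2^-1 * x).
Proof.
elim: N => [|N IH]; first by rewrite /cos0sum big_ord0 mulr0 add0r subrr.
rewrite /cos0sum big_ord_recr/= mulrDr -/(cos0sum N x) IH.
rewrite -[N.+1%:R]natr1; set y := (N%:R + 1) * x.
have -> : (N%:R + 1 + 2^-1) * x = y + 2^-1 * x by rewrite /y; ring.
have -> : (N%:R + 2^-1) * x = y - 2^-1 * x by rewrite /y; field.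
by rewrite sinB sinD; ring.
Qed.

Lemma sin_half_mono (x y : R) : 0 < x -> x <= y <= pi ->
  0 < sin (2^-1 * x) <= sin (2^-1 * y).
Proof.
move=> x0 /andP[xy ypi]; have := pi_gt0 R => pi0; apply/andP; split.
  by apply: sin_gt0_pi; rewrite mulr_gt0//=; lra.
set u := 4^-1 * (y + x); set v := 4^-1 * (y - x).
have -> : 2^-1 * y = u + v by rewrite /u /v; field.
have -> : 2^-1 * x = u - v by rewrite /u /v; field.
rewrite -subr_ge0 sinB sinD.
have cu : 0 <= cos u by apply: cos_ge0_pihalf; rewrite /u; lra.
have sv : 0 <= sin v by apply: sin_ge0_pi; rewrite /v; lra.
have := mulr_ge0 cu sv; lra.
Qed.

(* Adding [cos (M x) / (2 M sin (x/2))] to the remainder of the derivative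
   cancels the oscillating part of its derivative up to [O(1/M)]. *)
Lemma sin1sum_approx N (x : R) : 0 < x <= pi ->
  `|- sin1sum N x - 2^-1 * (x - pi)| <= (1 + pi) * ((N%:R + 2^-1)^-1 * (sin (2^-1 * x))^-1 ^+ 2).
Proof.
move=> /andP[x0 xpi]; set M := N%:R + 2^-1 : R.
have M0 : 0 < M by rewrite ltr_wpDl.
have sin_mono y : x <= y <= pi -> 0 < sin (2^-1 * x) <= sin (2^-1 * y).
  exact: sin_half_mono.
have sx0 : 0 < sin (2^-1 * x) by have /andP[] := sin_mono x (ltac:(by rewrite lexx xpi)).
pose z y := - sin1sum N y - 2^-1 * (y - pi) - cos (M * y) * (2 * M)^-1 * (sin (2^-1 * y))^-1.
pose dz y := cos (M * y) * cos (2^-1 * y) * (4 * M)^-1 * (sin (2^-1 * y))^-1 ^+ 2.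
have zdz y : x <= y <= pi -> is_derive y (1 : R) z (dz y).
  move=> hy; have /andP[_ sxy] := sin_mono y hy.
  have sy0 := lt_le_trans sx0 sxy.
  have h1 := is_derive_sin1sum N y.
  have h2 := @is_derive_scale R cos (fun y => - sin y) M y (fun y => is_derive_cos y).
  have h3 := @is_derive_scale R sin cos 2^-1 y (fun y => is_derive_sin y).
  rewrite /z; eapply is_derive_eq.
    by derive_fun; rewrite gt_eqF.
  rewrite /dz.
  have hd : cos0sum N y = (sin (M * y) - sin (2^-1 * y)) / (2 * sin (2^-1 * y)).
    have s20 : 2 * sin (2^-1 * y) != 0 by rewrite mulf_neq0// gt_eqF.
    by rewrite -dirichlet_kernel [X in X / _]mulrC mulfK.
  by rewrite hd; field; rewrite !gt_eqF.
pose S := (sin (2^-1 * x))^-1.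
have S1 : 1 <= S by rewrite /S invf_ge1// sin_le1.
have dzC y : x <= y <= pi -> `|dz y| <= (4 * M)^-1 * S ^+ 2.
  move=> hy; have /andP[_ sxy] := sin_mono y hy; have sy0 := lt_le_trans sx0 sxy.
  rewrite /dz normrM [`|_ ^+ 2|]ger0_norm ?sqr_ge0//.
  apply: ler_pM; [exact: normr_ge0|exact: sqr_ge0| |].
    rewrite normrM [`|(4 * M)^-1|]gtr0_norm ?invr_gt0 ?mulr_gt0// ler_piMl ?invr_ge0 ?mulr_ge0 ?(ltW M0)//.
    by rewrite normrM mulr_ile1// ?cos_max.
  by rewrite lerXn2r ?nnegrE ?invr_ge0 ?(ltW sy0) ?(ltW sx0)// lef_pV2.
(* At pi all the sines vanish, and so does cos (M pi) because [M] is a half-integer; the bound on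
   [dz] between [x] and pi therefore controls [z x]. *)
have zpi : z pi = 0.
  have -> : z pi = - sin1sum N pi - cos (M * pi) * (2 * M)^-1 * (sin (2^-1 * pi))^-1 by rewrite /z; ring.
  have -> : cos (M * pi) = 0 by rewrite /M mulrDl [2^-1 * _]mulrC cosDpihalf sin_nat_pi oppr0.
  by rewrite /sin1sum big1 ?oppr0 ?mul0r ?subr0// => n _; rewrite sin_nat_pi mul0r.
have := mean_value_bound xpi zdz dzC; rewrite zpi sub0r normrN => zx.
have -> : - sin1sum N x - 2^-1 * (x - pi) = z x + cos (M * x) * (2 * M)^-1 * S.
  by rewrite /z /S; ring.
rewrite (le_trans (ler_normD _ _))// (le_trans (lerD zx (lexx _)))//.
have h2 : `|cos (M * x) * (2 * M)^-1 * S| <= (2 * M)^-1 * S.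
  rewrite !normrM [`|S|]gtr0_norm ?(lt_le_trans ltr01)// ler_wpM2r ?(le_trans ler01)//.
  rewrite [`|(2 * M)^-1|]gtr0_norm ?invr_gt0 ?mulr_gt0// ler_piMl ?cos_max//.
  by rewrite invr_ge0 mulr_ge0// ltW.
rewrite (le_trans (lerD (lexx _) h2))// !invfM -/S.
have A0 : 0 < M^-1 by rewrite invr_gt0.
move: M^-1 A0 => A A0; have pi0 := pi_gt0 R.
have S2 : S <= S ^+ 2 by rewrite expr2 ler_pMl// (lt_le_trans ltr01).
have AS : A * S <= A * S ^+ 2 by rewrite ler_wpM2l// ltW.
have h3 : A * S ^+ 2 * (pi - x) <= A * S ^+ 2 * pi.
  by rewrite ler_wpM2l ?mulr_ge0 ?sqr_ge0 ?(ltW A0)//; lra.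
have h5 := mulr_ge0 (ltW A0) (sqr_ge0 S); have h4 := mulr_ge0 h5 (ltW pi0).
lra.
Qed.

(** Mean value bound on [x, pi] for the remainder, whose derivative is estimated by
    [sin1sum_approx]; that estimate is worst at the left end, since sin (y/2) increases there. *)
Lemma cos2sum_approx N (x : R) : 0 < x <= pi ->
  `|cos2sum N pi - cos2sum N x + 4^-1 * (x - pi) ^+ 2| <=
  (1 + pi) * pi * (sin (2^-1 * x))^-1 ^+ 2 * (N%:R + 2^-1)^-1.
Proof.
move=> /andP[x0 xpi]; have pi0 := pi_gt0 R.
have M0 : 0 < (N%:R + 2^-1)^-1 :> R by rewrite invr_gt0 ltr_wpDl.
have /andP[sx0 _] := @sin_half_mono x x x0 (ltac:(by rewrite lexx xpi)).
pose f y := cos2sum N y - 4^-1 * (y - pi) ^+ 2.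
pose df y := - sin1sum N y - 2^-1 * (y - pi).
have fdf y : x <= y <= pi -> is_derive y (1 : R) f (df y).
  move=> _; have h := is_derive_cos2sum N y.
  by eapply is_derive_eq; [derive_fun|rewrite /df; field].
have dfC y : x <= y <= pi ->
    `|df y| <= (1 + pi) * ((N%:R + 2^-1)^-1 * (sin (2^-1 * x))^-1 ^+ 2).
  move=> hy; have /andP[xy ypi] := hy; have /andP[_ sxy] := sin_half_mono x0 hy.
  have y0 : 0 < y <= pi by rewrite (lt_le_trans x0 xy) ypi.
  have sy0 := lt_le_trans sx0 sxy.
  apply: (le_trans (sin1sum_approx N y0)).
  have p1 : 0 <= 1 + pi :> R by lra.
  apply: (ler_wpM2l p1); apply: (ler_wpM2l (ltW M0)).
  by rewrite lerXn2r ?nnegrE ?invr_ge0 ?(ltW sy0) ?(ltW sx0)// lef_pV2.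
have := mean_value_bound xpi fdf dfC.
have -> : f pi - f x = cos2sum N pi - cos2sum N x + 4^-1 * (x - pi) ^+ 2 by rewrite /f; ring.
move=> h; apply: (le_trans h).
rewrite [leRHS](_ : _ = (1 + pi) * ((N%:R + 2^-1)^-1 * (sin (2^-1 * x))^-1 ^+ 2) * pi); last by ring.
rewrite ler_wpM2l//; last by lra.
by apply: mulr_ge0; [lra|apply: mulr_ge0; [exact: ltW|exact: sqr_ge0]].
Qed.

Lemma cos2sum_limit (x e : R) : 0 < x <= pi -> 0 < e ->
  exists M0 : nat, forall M, (M0 <= M)%N ->
  `|cos2sum M pi - cos2sum M x + 4^-1 * (x - pi) ^+ 2| <= e.
Proof.
move=> hx e0; set C := (1 + pi) * pi * (sin (2^-1 * x))^-1 ^+ 2.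
have C0 : 0 <= C.
  have pi0 := pi_gt0 R; rewrite mulr_ge0 ?sqr_ge0// mulr_ge0 ?(ltW pi0)//; lra.
have [M0 _ hM] := near_infty_natSinv_lt (PosNum (divr_gt0 e0 (ltr_wpDl C0 ltr01))).
exists M0.+1 => -[//|M] /=; rewrite ltnS => MM.
apply: (le_trans (cos2sum_approx M.+1 hx)); rewrite -/C.
have := hM M MM; rewrite /= ltr_pdivlMr ?ltr_wpDl// => h.
apply: le_trans (ltW h); rewrite mulrC; apply: ler_pM => //.
- by rewrite lef_pV2 ?posrE ?ltr_wpDr// lerDl.
- by rewrite lerDl.
Qed.

Lemma cos2sum_reflect N (x : R) : cos2sum N (2 * pi - x) = cos2sum N x.
Proof.
apply: eq_bigr => n _; congr (_ * _).
have [hc hs] := cos_sin_nat2pi R n.+1.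
by rewrite mulrBr cosB hc hs mul1r mul0r addr0.
Qed.

(** Eigenfunction expansion of pi times the Green function of -d^2/dx^2 on [0, pi] with zero
    boundary values, that is, of pi min (x, a) - x a. *)
Definition green_sum (N : nat) (x a : R) : R :=
  \sum_(n < N) 2 * sin (n.+1%:R * x) * sin (n.+1%:R * a) * (n.+1%:R ^+ 2)^-1.

Lemma green_sumC N x a : green_sum N x a = green_sum N a x.
Proof. by apply: eq_bigr => n _; ring. Qed.

Lemma green_sumE N x a : green_sum N x a = cos2sum N (x - a) - cos2sum N (x + a).
Proof.
rewrite /cos2sum -sumrB; apply: eq_bigr => n _.
by rewrite mulrBr mulrDr cosB cosD; ring.
Qed.

(** The rate in [cos2sum_limit] may depend on the point and its bound degenerates near 0. This
    telescoping tail bound does not see [x] and [a]: it turns the pointwise limit into a uniform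
    rate. *)
Lemma green_sum_tail (N k : nat) x a :
  `|green_sum (N.+1 + k) x a - green_sum N.+1 x a| <= 2 * (N.+1%:R^-1 - (N.+1 + k)%:R^-1).
Proof.
elim: k => [|k IH]; first by rewrite addn0 !subrr normr0 mulr0.
rewrite addnS; set M := (N.+1 + k)%N in IH *.
rewrite {1}/green_sum big_ord_recr/= -/(green_sum M x a) addrAC.
rewrite (le_trans (ler_normD _ _))// (le_trans (lerD IH (lexx _)))//.
set t := `|_|; have : t <= 2 * (M.+1%:R ^+ 2)^-1.
  rewrite /t !normrM normfV [`|2|]gtr0_norm// [`|_ ^+ 2|]ger0_norm ?sqr_ge0//.
  rewrite ler_wpM2r ?invr_ge0 ?sqr_ge0// -mulrA ler_piMr// mulr_ile1// ?sin_max//.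
move: t => t ht.
have : (M.+1%:R ^+ 2)^-1 <= M%:R^-1 - M.+1%:R^-1 :> R.
  rewrite -natr1; have : 0 < M%:R :> R by rewrite ltr0n /M addSn.
  move: (M%:R : R) => y y0.
  have -> : y^-1 - (y + 1)^-1 = (y * (y + 1))^-1 by field; rewrite !gt_eqF//; lra.
  rewrite lef_pV2 ?posrE ?exprn_gt0 ?mulr_gt0//; nra.
move: ht; move: ((M.+1%:R ^+ 2)^-1 : R) (M%:R^-1 : R) (M.+1%:R^-1 : R) (N.+1%:R^-1 : R) => ? ? ? ?; lra.
Qed.

Let green_lt N (x a : R) : 0 < a -> a < x -> x < pi ->
  `|green_sum N.+1 x a - (pi * a - x * a)| <= 2 * N.+1%:R^-1.
Proof.
move=> a0 ax xpi; have pi0 := pi_gt0 R; apply/ler_addgt0Pr => e e0.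
have e2 : 0 < e / 2 by rewrite divr_gt0.
(* [cos2sum_limit] needs an argument in (0, pi], so [x + a] is reflected when it exceeds pi. *)
have [r r0 [cr qr]] : exists2 r, 0 < r <= pi &
    (forall M, cos2sum M (x + a) = cos2sum M r) /\ (x + a - pi) ^+ 2 = (r - pi) ^+ 2.
  have [h|h] := leP (x + a) pi; first by exists (x + a); rewrite ?h ?addr_gt0//; lra.
  exists (2 * pi - (x + a)); first by lra.
  by split=> [M|]; [rewrite cos2sum_reflect|ring].
have xa : 0 < x - a <= pi by lra.
have [M1 h1] := cos2sum_limit xa e2; have [M2 h2] := cos2sum_limit r0 e2.
pose k := (M1 + M2)%N.
have {}h1 := h1 (N.+1 + k)%N (leq_trans (leq_addr _ _) (leq_addl _ _)).
have {}h2 := h2 (N.+1 + k)%N (leq_trans (leq_addl _ _) (leq_addl _ _)).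
have ht := green_sum_tail N k x a.
move: ht; rewrite [green_sum (_ + _) _ _]green_sumE cr; move: h1 h2 qr.
set A := cos2sum _ pi; set X := cos2sum _ (x - a); set Y := cos2sum _ r => h1 h2 qr ht.
have : 0 <= (N.+1 + k)%:R^-1 :> R by rewrite invr_ge0.
move: ht; move: (green_sum N.+1 x a) (N.+1%:R^-1 : R) ((N.+1 + k)%:R^-1 : R) => G b c.
(* The limits of the two cosine sums differ by exactly the Green function. *)
have qE : pi * a - x * a = 4^-1 * (x - a - pi) ^+ 2 - 4^-1 * (x + a - pi) ^+ 2 by field.
rewrite qE qr; move: h1 h2.
move: (4^-1 * (x - a - pi) ^+ 2) (4^-1 * (r - pi) ^+ 2) => q1 q2.
rewrite !ler_norml; lra.
Qed.

Lemma right_limit_le (g : R -> R) (x b c : R) : x < b -> contf g ->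
  (forall y, x < y < b -> g y <= c) -> g x <= c.
Proof.
move=> xb cg gc.
have h : g y @[y --> x^'+] --> g x by exact: cvg_at_right_filter (cg x).
rewrite -(cvg_lim (@Rhausdorff R) h); apply: limr_le.
  by apply/cvg_ex; exists (g x).
near=> y; apply: gc; apply/andP; split; near: y.
  exact: nbhs_right_gt.
exact: nbhs_right_lt.
Unshelve. all: by end_near. Qed.

Lemma green_approx N (x a : R) : 0 <= x <= pi -> 0 <= a <= pi ->
  `|green_sum N.+1 x a - (pi * Num.min x a - x * a)| <= 2 * N.+1%:R^-1.
Proof.
have b0 : 0 <= 2 * N.+1%:R^-1 :> R by rewrite mulr_ge0.
wlog ax : x a / a <= x => [hw hx ha|].
  have [ax|xa] := leP a x; first by move: (hw x a ax hx ha); rewrite min_r.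
  by move: (hw a x (ltW xa) ha hx); rewrite min_r ?(ltW xa)// green_sumC (mulrC a).
move=> /andP[x0 xpi] /andP[a0 api]; rewrite min_r//.
have [aE|a0'] := eqVneq a 0.
  rewrite aE /green_sum big1 ?mulr0 ?subrr ?normr0// => n _.
  by rewrite mulr0 sin0 mulr0 mul0r.
have [xE|xpi'] := eqVneq x pi.
  rewrite xE /green_sum big1 ?subrr ?subr0 ?normr0// => n _.
  by rewrite sin_nat_pi mulr0 !mul0r.
have {a0' a0}a0 : 0 < a by rewrite lt_neqAle eq_sym a0' a0.
have {xpi' xpi}xpi : x < pi by rewrite lt_neqAle xpi' xpi.
move: ax; rewrite le_eqVlt => /predU1P[ax|ax]; last exact: green_lt.
rewrite ax in a0 *.
(* The diagonal is approached from the right, where [green_lt] applies. *)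
apply: (@right_limit_le (fun y => `|green_sum N.+1 y x - (pi * x - y * x)|) x pi) => //.
  apply: (@contf_comp _ _ (fun y => `|y|) (fun y => green_sum N.+1 y x - (pi * x - y * x))).
    exact: norm_continuous.
  rewrite /green_sum; continuity; apply: contf_sum => n; continuity.
by move=> y /andP[xy ypi]; exact: green_lt.
Qed.

End green_series.

(** * The sine series of the triangular wave *)

Section triwave_expansion.
Context (R : realType).

(** The tent is a multiple of the Green function with source at the midpoint, which gives these
    coefficients; index [n] is frequency [n.+1]. *)
Definition triwave_coef (n : nat) : R :=
  8 / pi ^+ 2 * sin (n.+1%:R * (pi / 2)) * (n.+1%:R ^+ 2)^-1.

Local Notation S := (sinesum triwave_coef).

Lemma sinesum_triwaveE N (t : R) : S N t = 4 / pi ^+ 2 * green_sum N (pi * t) (pi / 2).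
Proof.
rewrite /green_sum mulr_sumr; apply: eq_bigr => n _.
rewrite /triwave_coef (_ : n.+1%:R * pi * t = n.+1%:R * (pi * t)); last by ring.
by move: (sin (n.+1%:R * (pi / 2))) (sin (n.+1%:R * (pi * t))) ((n.+1%:R ^+ 2)^-1)
  ((pi ^+ 2)^-1) => a b c d; ring.
Qed.

Lemma tent_approx N (t : R) : 0 <= t <= 1 -> `|tent t - S N.+1 t| <= 2 * N.+1%:R^-1.
Proof.
move=> /andP[t0 t1]; have pi0 := pi_gt0 R.
have hx : 0 <= pi * t <= pi.
  by rewrite mulr_ge0 ?(ltW pi0)//= -[leRHS]mulr1 ler_wpM2l// ltW.
have ha : 0 <= (pi : R) / 2 <= pi by lra.
have h := green_approx N hx ha.
have pn : (pi : R) != 0 by rewrite gt_eqF.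
have tE : tent t = 4 / pi ^+ 2 * (pi * Num.min (pi * t) (pi / 2) - pi * t * (pi / 2)).
  rewrite /tent; case: ifPn => [t2|]; last rewrite -ltNge => t2.
    rewrite min_l; last by rewrite ler_wpM2l// ltW.
    by move: (pi : R) pn => p pn; field.
  rewrite min_r; last by rewrite ler_wpM2l// ltW.
  by move: (pi : R) pn => p pn; field.
rewrite tE sinesum_triwaveE -(mulrBr (4 / pi ^+ 2)) normrM distrC.
have c1 : `|4 / pi ^+ 2| <= 1 :> R.
  rewrite ger0_norm ?divr_ge0 ?sqr_ge0// ler_pdivrMr ?exprn_gt0// mul1r.
  by have := pi_ge2 R; nra.
by rewrite (le_trans (ler_wpM2r (normr_ge0 _) c1))// mul1r.
Qed.

(** Only odd frequencies carry a nonzero coefficient, and their sines change sign under a shift by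
    1. The parity argument is encoded in sin y cos y = 0 with y = (n+1) pi / 2. *)
Lemma sinesum_triwave1 N (t : R) : S N (t + 1) = - S N t.
Proof.
rewrite /sinesum -sumrN; apply: eq_bigr => n _; rewrite /triwave_coef.
set y := n.+1%:R * (pi / 2).
have yE : n.+1%:R * pi = y + y :> R by rewrite /y; field.
rewrite mulrDr mulr1 sinD sin_nat_pi mulr0 addr0.
have sc : sin y * cos y = 0.
  have := sin_nat_pi R n.+1; rewrite yE sinD mulrC -mulr2n => /eqP.
  by rewrite -mulr_natl mulf_eq0 pnatr_eq0/= mulrC => /eqP.
have -> : cos (n.+1%:R * pi) = 2 * cos y ^+ 2 - 1.
  by rewrite yE cosD; have := cos2Dsin2 y; nra.
transitivity (8 / pi ^+ 2 * (n.+1%:R ^+ 2)^-1 * sin (n.+1%:R * pi * t) *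
  (2 * (sin y * cos y) * cos y - sin y)); last rewrite sc.
  all: move: (sin y) (cos y) (sin _) ((n.+1%:R ^+ 2)^-1) ((pi ^+ 2)^-1) => *; ring.
Qed.

Lemma sinesum_triwave_nat N (t : R) (k : nat) : S N (t + k%:R) = (-1) ^+ k * S N t.
Proof.
elim: k => [|k IH]; first by rewrite addr0 mul1r.
by rewrite -natr1 addrA sinesum_triwave1 IH exprS mulN1r mulNr.
Qed.

Lemma sinesum_triwave_int N (t : R) (z : int) : S N (t + z%:~R) = (-1) ^ z * S N t.
Proof.
case: z => k; first exact: sinesum_triwave_nat.
have := sinesum_triwave_nat N (t - k.+1%:R) k.+1; rewrite subrK NegzE mulrNz => ->.
by rewrite mulrA -exprnN mulVf ?mul1r// expf_neq0// oppr_eq0 oner_eq0.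
Qed.

Lemma triwave_approx N (t : R) : `|triwave t - S N.+1 t| <= 2 * N.+1%:R^-1.
Proof.
rewrite /triwave; set z := Num.floor t.
have -> : S N.+1 t = (-1) ^ z * S N.+1 (t - z%:~R) by rewrite -sinesum_triwave_int subrK.
rewrite -mulrBr normrM (_ : `|_ ^ z| = 1) ?mul1r; last first.
  by case: (z) => k; rewrite /exprz ?normfV normrX normrN1 expr1n ?invr1.
apply: tent_approx; have /andP[] := floor_itv t; rewrite intrD -/z; lra.
Qed.

Lemma triwave_coef0 : 0 < triwave_coef 0.
Proof.
rewrite /triwave_coef mul1r sin_pihalf expr1n invr1 !mulr1 divr_gt0// exprn_gt0//.
exact: pi_gt0.
Qed.

Lemma triwave_coef_le n : `|triwave_coef n| <= triwave_coef 0 / (n.+1%:R ^+ 2).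
Proof.
rewrite /triwave_coef mul1r sin_pihalf expr1n invr1 !mulr1.
rewrite normrM normrM [`|8 / _|]ger0_norm ?divr_ge0 ?sqr_ge0//.
rewrite normfV [`|n.+1%:R ^+ 2|]ger0_norm ?sqr_ge0// ler_wpM2r ?invr_ge0 ?sqr_ge0//.
by rewrite ler_piMr ?divr_ge0 ?sqr_ge0// sin_max.
Qed.

Variables (q : R) (q1 : 1 < q).

Lemma inL_triwave (j : nat) : inL q (fun t => triwave (j%:R * t)).
Proof. exact: Lfun_triwave. Qed.

Lemma dilated_triwaveE (j : nat) : dilated_triwave q1 j = Lcl q1 (fun t => triwave (j%:R * t)).
Proof.
rewrite (Lcl_Sub q1 (inL_triwave j)) /dilated_triwave; congr Lclass.
exact/LfuneqP.
Qed.

(** The approximation is uniform on the whole line, so it survives every dilation, and on (0, 1) the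
    supremum bounds the L_q norm. *)
Lemma triwave_expansion n :
  (fun J => \sum_(j < J) triwave_coef j *: sine q1 (j.+1 * n.+1)) @ \oo -->
  (dilated_triwave q1 n.+1 : L01 q1).
Proof.
apply/cvgrPdist_le => e e0.
have [k _ hk] := near_infty_natSinv_lt (PosNum (divr_gt0 e0 (ltr0n R 2))).
exists k.+1 => // -[//|J] /=; rewrite ltnS => kJ.
have -> : \sum_(j < J.+1) triwave_coef j *: sine q1 (j.+1 * n.+1) =
    Lcl q1 (fun t => S J.+1 (n.+1%:R * t)).
  by rewrite -sum_sine; apply: eq_bigr => j _; rewrite mulnC.
have cl : contf (fun x : R => n.+1%:R * x) by continuity.
have inS : inL q (fun t => S J.+1 (n.+1%:R * t)).
  by apply: (inL_contf q1); exact: (contf_comp (@contf_sinesum _ triwave_coef J.+1) cl).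
rewrite dilated_triwaveE -LclB//; last exact: inL_triwave.
apply: norm_Lcl_sup => //; [by apply: inLB => //; exact: inL_triwave|exact: ltW|].
move=> t _; rewrite (le_trans (triwave_approx _ _))//.
by have := hk J kJ; rewrite /= ltr_pdivlMr// mulrC => /ltW.
Qed.

End triwave_expansion.

(** * Totality of the sines *)

Section sine_density.
Context (R : realType) (q : R) (q1 : 1 < q).
Local Notation mu := (@lebesgue_measure R).
Local Notation T := (measurableTypeR R).
Local Notation closed_span := (in_closed_span (fun n => sine q1 n.+1)).

Let q0 : 0 < q. Proof. by rewrite (lt_trans ltr01). Qed.

Lemma small_root (c e : R) : 0 <= c -> 0 < e ->
  exists2 h, 0 < h & forall k, 0 <= k -> k <= h -> c * k `^ q^-1 <= e.
Proof.
move=> c0 e0; have c1 : 0 < c + 1 by rewrite ltr_wpDl.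
exists ((e / (c + 1)) `^ q); first by apply: powR_gt0; exact: divr_gt0.
move=> k k0 kh; apply: (@le_trans _ _ ((c + 1) * (e / (c + 1)))).
  apply: ler_pM => //; first by rewrite powR_ge0.
    by rewrite lerDl.
  rewrite (@le_trans _ _ (((e / (c + 1)) `^ q) `^ q^-1))//.
    by rewrite ge0_ler_powR ?nnegrE ?invr_ge0 ?powR_ge0// ltW.
  by rewrite -powRrM mulfV ?gt_eqF// powRr1// divr_ge0// ltW.
by rewrite mulrC divfK// gt_eqF.
Qed.

Definition green (s t : R) : R := Num.min t s - t * s.

Lemma contf_green s : contf (green s).
Proof.
have cn : contf (fun t : R => `|t - s|).
  apply: (@contf_comp _ _ (fun y => `|y|) (fun t => t - s)); first exact: norm_continuous.
  continuity.
have : contf (fun t : R => (t + s - `|t - s|) / 2 - t * s) by continuity.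
by congr contf; apply/funext => t; rewrite /green minr_absE.
Qed.

Let inL_green s : inL q (green s).
Proof. by apply: (inL_contf q1); exact: contf_green. Qed.

Lemma green_in_span (s : R) : 0 <= s <= 1 -> closed_span (Lcl q1 (green s)).
Proof.
move=> /andP[s0 s1]; have pi0 := pi_gt0 R.
pose a n : R := 2 / pi ^+ 2 * sin (n.+1%:R * (pi * s)) * (n.+1%:R ^+ 2)^-1.
have aE N t : sinesum a N t = (pi ^+ 2)^-1 * green_sum N (pi * t) (pi * s).
  rewrite /green_sum mulr_sumr; apply: eq_bigr => n _.
  rewrite /a (_ : n.+1%:R * pi * t = n.+1%:R * (pi * t)); last by ring.
  by move: (sin (n.+1%:R * (pi * s))) (sin (n.+1%:R * (pi * t))) ((n.+1%:R ^+ 2)^-1)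
    ((pi ^+ 2)^-1) => *; ring.
have approx N t : 0 < t < 1 -> `|green s t - sinesum a N.+1 t| <= 2 * N.+1%:R^-1.
  move=> /andP[t0 t1].
  have ht : 0 <= pi * t <= pi.
    by rewrite mulr_ge0 ?(ltW pi0) ?(ltW t0)//= -[leRHS]mulr1 ler_wpM2l// ltW.
  have hs : 0 <= pi * s <= pi.
    by rewrite mulr_ge0 ?(ltW pi0)//= -[leRHS]mulr1 ler_wpM2l// ltW.
  move: (green_approx N ht hs) => h.
  have -> : green s t = (pi ^+ 2)^-1 * (pi * Num.min (pi * t) (pi * s) - pi * t * (pi * s)).
    have pn : (pi : R) != 0 by rewrite gt_eqF.
    rewrite /green; have [ts|st] := leP t s.
      rewrite min_l; last by rewrite ler_wpM2l// ltW.
      by move: (pi : R) pn => p pn; field.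
    rewrite min_r; last by rewrite ler_wpM2l// ltW.
    by move: (pi : R) pn => p pn; field.
  rewrite distrC in h; rewrite aE -(mulrBr (pi ^+ 2)^-1) normrM.
  have c1 : `|(pi ^+ 2)^-1| <= 1 :> R.
    rewrite ger0_norm ?invr_ge0 ?sqr_ge0// invf_le1 ?exprn_gt0//.
    by have := pi_ge2 R; nra.
  by rewrite (le_trans (ler_wpM2r (normr_ge0 _) c1))// mul1r.
move=> d d0.
have [k _ hk] := near_infty_natSinv_lt (PosNum (divr_gt0 d0 (ltr0n R 2))).
exists k.+1, a.
have -> : \sum_(n < k.+1) a n *: sine q1 n.+1 = Lcl q1 (sinesum a k.+1).
  have := sum_sine q1 a k.+1 1; under eq_bigr do rewrite mul1n.
  by move=> ->; congr Lcl; apply/funext => x; rewrite mul1r.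
have inS : inL q (sinesum a k.+1) by apply: (inL_contf q1); exact: contf_sinesum.
rewrite -LclB//.
have hk' := hk k (leqnn k); rewrite /= ltr_pdivlMr// mulrC in hk'.
apply: le_lt_trans hk'; apply: norm_Lcl_sup.
- exact: inLB.
- by rewrite mulr_ge0.
- exact: approx.
Qed.

Definition step (s t : R) : R := if t <= s then 1 else 0.

Lemma measurable_step s : measurable_fun setT (step s : T -> R).
Proof.
apply: measurable_fun_ifT => //; exact: measurable_fun_ler.
Qed.

Lemma inL_step s : inL q (step s).
Proof.
apply: (@inL_bounded R q q1 (step s) 1); first exact: measurable_step.
by move=> x _; rewrite /step; case: ifP => _; rewrite ?normr1 ?normr0.
Qed.

(** The quotient [(green (s + h) - green s) / h] equals the limit function outside [s, s + h] and
    differs from it by at most 1 inside, so the distance is at most h^(1/q). *)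
Lemma id_sub_step_in_span s : 0 <= s -> s < 1 ->
  closed_span (Lcl q1 (fun t => (1 - t) - step s t)).
Proof.
move=> s0 s1.
have cid : inL q (fun t : R => 1 - t) by apply: (inL_contf q1); continuity.
have inH : inL q (fun t => 1 - t - step s t) by apply: inLB => //; exact: inL_step.
apply: in_closed_span_closed => d d0.
have d2 : 0 < d / 2 by rewrite divr_gt0.
have [h0 h00 hh] := small_root ler01 d2.
pose h := Num.min h0 (1 - s).
have hpos : 0 < h by rewrite lt_min h00 subr_gt0.
have hle : h <= h0 by rewrite ge_min lexx.
have hs : s + h <= 1 by rewrite addrC -lerBrDr ge_min lexx orbT.
have inD : inL q (fun t => green (s + h) t - green s t) by exact: inLB.
exists (Lcl q1 (fun t => h^-1 * (green (s + h) t - green s t))).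
  rewrite LclZ// LclB//.
  apply: in_closed_spanZ; apply: in_closed_spanD; first by apply: green_in_span; rewrite hs andbT addr_ge0// ltW.
  by rewrite -scaleN1r; apply: in_closed_spanZ; apply: green_in_span; rewrite s0 ltW.
have inG := inLZ q1 h^-1 inD.
rewrite -LclB//.
have lt2 : d / 2 < d by rewrite ltr_pdivrMr// ltr_pMr// ltrDl.
apply: (le_lt_trans _ lt2); apply: le_trans (hh h (ltW hpos) hle).
have hE : s + h - s = h by rewrite addrAC subrr add0r.
rewrite -[in X in _ <= X]hE.
apply: norm_Lcl_le => //; [exact: inLB|by rewrite lerDl ltW| |].
- move=> t _; rewrite in_itv/= => /andP[st th].
  rewrite /green (min_l th) (min_r st) /step.
  have u0 : 0 <= (t - s) / h by rewrite divr_ge0 ?subr_ge0// ltW.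
  have u1 : (t - s) / h <= 1 by rewrite ler_pdivrMr// mul1r lerBlDl.
  have -> : h^-1 * (t - t * (s + h) - (s - t * s)) = (t - s) / h - t.
    by field; rewrite gt_eqF.
  case: (leP t s) => ts; last by rewrite ler_norml; lra.
  have -> : t = s by apply/eqP; rewrite eq_le ts st.
  rewrite subrr mul0r ler_norml; lra.
- move=> t t01; rewrite in_itv/= negb_and -!ltNge => /orP[ts|ht].
    have tsh : t <= s + h by rewrite (le_trans (ltW ts))// lerDl ltW.
    rewrite /green (min_l tsh) (min_l (ltW ts)) /step (ltW ts).
    by field; rewrite gt_eqF.
  have st : s < t by rewrite (le_lt_trans _ ht)// lerDl ltW.
  rewrite /green (min_r (ltW ht)) (min_r (ltW st)) /step leNgt st /=.
  by field; rewrite gt_eqF.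
Qed.

Lemma step_in_span s : 0 <= s <= 1 -> closed_span (Lcl q1 (step s)).
Proof.
have lt1 r : 0 <= r -> r < 1 -> closed_span (Lcl q1 (step r)).
  move=> r0 r1.
  have cid : inL q (fun t : R => 1 - t) by apply: (inL_contf q1); continuity.
  have inH u : inL q (fun t => 1 - t - step u t) by apply: inLB => //; exact: inL_step.
  have step0 : Lcl q1 (step 0) = 0.
    apply/eqP; rewrite -normr_le0; apply: norm_Lcl_sup => //; first exact: inL_step.
    by move=> x /andP[x0 _]; rewrite /step (leNgt x 0) x0 normr0.
  (* On (0, 1) the step at 0 vanishes, so the case [s = 0] puts [1 - t] itself in the closed span;
     subtraction isolates the step at [r]. *)
  have := in_closed_spanD (id_sub_step_in_span (lexx 0) ltr01)
    (in_closed_spanZ (-1) (id_sub_step_in_span r0 r1)).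
  rewrite (LclB q1 cid (inL_step 0)) (LclB q1 cid (inL_step r)).
  by rewrite step0 subr0 scaleN1r opprB addrC subrK.
move=> /andP[s0]; rewrite le_eqVlt => /orP[/eqP ->|]; last exact: lt1.
(* No difference quotient to the right is available at [s = 1]; that step is a limit of steps at
   [1 - h]. *)
apply: in_closed_span_closed => d d0; have d2 : 0 < d / 2 by rewrite divr_gt0.
have [h0 h00 hh] := small_root ler01 d2.
pose h := Num.min h0 1.
have hpos : 0 < h by rewrite lt_min h00 ltr01.
have hle : h <= h0 by rewrite ge_min lexx.
have h1 : h <= 1 by rewrite ge_min lexx orbT.
exists (Lcl q1 (step (1 - h))); first by apply: lt1; rewrite ?subr_ge0// ltrBlDr ltrDl.
rewrite -LclB; [|exact: inL_step|exact: inL_step].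
have lt2 : d / 2 < d by rewrite ltr_pdivrMr// ltr_pMr// ltrDl.
apply: (le_lt_trans _ lt2); apply: le_trans (hh h (ltW hpos) hle).
have hE : 1 - (1 - h) = h by rewrite opprB addrC subrK.
rewrite -[in X in _ <= X]hE.
apply: norm_Lcl_le => //; [exact: (inLB q1 (inL_step _) (inL_step _))|by rewrite lerBlDr lerDl ltW| |].
- by move=> t _ _; rewrite /step; do 2 case: ifP => _; rewrite ler_norml; lra.
- move=> t /andP[_ t1]; rewrite in_itv/= (ltW t1) andbT -ltNge => th.
  by rewrite /step (ltW t1) (ltW th) subrr.
Qed.

Lemma uniform_continuity01 (g : R -> R) : contf g -> forall e, 0 < e ->
  exists2 d, 0 < d & forall x y, 0 <= x <= 1 -> `|x - y| < d -> `|g x - g y| < e.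
Proof.
move=> cg e e0.
have /compact_near_coveringP nc : compact (`[0, 1]%classic : set R) by exact: segment_compact.
pose P (d x : R) := forall y, `|x - y| < d -> `|g x - g y| < e.
have [x _|r /= r0 hr] := nc R (0^'+) P _.
  have /cvgrPdist_lt/(_ (e / 2)) := cg x.
  rewrite divr_gt0// => /(_ isT)[r /= r0 hr].
  have r2 : 0 < r / 2 by rewrite divr_gt0.
  exists (ball x (r / 2), [set i | i < r / 2]); first split => /=.
  - exact: nbhsx_ballx.
  - exact: nbhs_right_lt.
  move=> [x' i] /= [xx' ir] y x'y.
  have h1 : `|g x - g x'| < e / 2.
    by apply: hr => /=; rewrite (lt_trans xx')// ltr_pdivrMr// ltr_pMr// ltrDl.
  have h2 : `|g x - g y| < e / 2.
    apply: hr => /=; rewrite -[x - y](subrKA x') (le_lt_trans (ler_normD _ _))//.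
    by rewrite (splitr r) ltrD// (lt_trans x'y).
  rewrite -[g x' - g y](subrKA (g x)) (le_lt_trans (ler_normD _ _))//.
  by rewrite (splitr e) ltrD// distrC.
exists (r / 2); first by rewrite divr_gt0.
move=> x y x01; apply: (hr (r / 2)) => //=.
- by rewrite sub0r normrN gtr0_norm ?divr_gt0// ltr_pdivrMr// ltr_pMr// ltrDl.
- by rewrite divr_gt0.
Qed.

Lemma contf_in_span (g : R -> R) : contf g -> closed_span (Lcl q1 g).
Proof.
move=> cg; apply: in_closed_span_closed => d d0.
have d2 : 0 < d / 2 by rewrite divr_gt0.
have [r r0 hr] := uniform_continuity01 cg d2.
have [m _ hm] := near_infty_natSinv_lt (PosNum r0).
have {hm} /= mr := hm m (leqnn m).
pose M : R := m.+1%:R; have M0 : 0 < M by rewrite ltr0n.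
pose D (j : nat) t := step (j.+1%:R / M) t - step (j%:R / M) t.
have inD j : inL q (D j) by exact: (inLB q1 (inL_step _) (inL_step _)).
pose A (j : 'I_m.+1) t := g (j%:R / M) * D j t.
have inA j : inL q (A j) by exact: inLZ.
exists (Lcl q1 (fun t => \sum_(j < m.+1) A j t)).
  rewrite Lcl_sum//; apply: in_closed_span_sum => j.
  rewrite /A LclZ// LclB; [|exact: inL_step|exact: inL_step].
  apply: in_closed_spanZ; apply: in_closed_spanD.
    by apply: step_in_span; rewrite divr_ge0//= ?(ltW M0)// ler_pdivrMr// mul1r ler_nat.
  rewrite -scaleN1r; apply: in_closed_spanZ; apply: step_in_span.
  by rewrite divr_ge0//= ?(ltW M0)// ler_pdivrMr// mul1r ler_nat ltnW.
rewrite -LclB; [|exact: (inL_contf q1)|exact: inL_sum].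
have lt2 : d / 2 < d by rewrite ltr_pdivrMr// ltr_pMr// ltrDl.
apply: (le_lt_trans _ lt2); apply: norm_Lcl_sup; [|exact: ltW|].
  exact: (inLB q1 (inL_contf q1 cg) (inL_sum q1 _ inA)).
move=> t /andP[t0 t1].
(* On (0, 1) the [D j] telescope to a partition of unity, so [g t] and [d / 2] can both be spread
   over the cells. *)
have sumD : \sum_(j < m.+1) D j t = 1.
  rewrite -(big_mkord xpredT (fun j => D j t)) telescope_sumr// /step mul0r.
  by rewrite divff ?gt_eqF// (ltW t1) leNgt t0 subr0.
have D01 j : (D j t = 0) \/ (D j t = 1 /\ j%:R / M < t <= j.+1%:R / M).
  rewrite /D /step; case: (leP t (j%:R / M)) => h1; case: (leP t (j.+1%:R / M)) => h2.
  - by left; rewrite subrr.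
  - have : j%:R / M <= j.+1%:R / M by rewrite ler_pM2r ?invr_gt0// ler_nat.
    by move=> /(le_trans h1); rewrite leNgt h2.
  - by right; rewrite subr0.
  - by left; rewrite subrr.
have -> : g t = \sum_(j < m.+1) g t * D j t by rewrite -mulr_sumr sumD mulr1.
rewrite -sumrB (le_trans (ler_norm_sum _ _ _))//.
have -> : d / 2 = \sum_(j < m.+1) d / 2 * D j t by rewrite -mulr_sumr sumD mulr1.
apply: ler_sum => j _.
rewrite /A -mulrBl normrM; have [->|[-> /andP[h1 h2]]] := D01 j.
  by rewrite normr0 !mulr0.
rewrite normr1 !mulr1 ltW//; apply: hr; first by rewrite !ltW.
rewrite gtr0_norm ?subr_gt0//; apply: le_lt_trans mr.
by rewrite lerBlDr (le_trans h2)// -natr1 mulrDl mul1r addrC.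
Qed.

Definition clamp (M x : R) : R := Num.max (- M) (Num.min M x).

Lemma contf_clamp M : contf (clamp M).
Proof.
move=> x; apply: (@continuous_max R R (fun=> - M) (fun y => Num.min M y)); first exact: cst_continuous.
by apply: continuous_min; [exact: cst_continuous|exact: cvg_id].
Qed.

Lemma normr_clamp M x : 0 <= M -> `|clamp M x| <= M.
Proof.
move=> M0; have NM : - M <= M by rewrite (le_trans _ M0)// oppr_le0.
by rewrite ler_norml le_max lexx /= ge_max NM ge_min lexx.
Qed.

Lemma clamp_id M x : `|x| <= M -> clamp M x = x.
Proof. by rewrite ler_norml => /andP[h1 h2]; rewrite /clamp min_r// max_r. Qed.

Lemma normr_sub_clamp M x y : 0 <= M -> `|x| <= M -> `|x - clamp M y| <= `|x - y|.
Proof.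
move=> M0; rewrite ler_norml => /andP[h1 h2]; rewrite /clamp.
by case: (leP M y) => My; [case: (leP (- M) M)|case: (leP (- M) y)] => h;
  case: (ler0P (x - y)) => ?; rewrite ?ler_norml; lra.
Qed.

Lemma normr_sub_clamp0 M x : 0 <= M -> `|x - clamp M x| <= `|x|.
Proof.
move=> M0; rewrite /clamp.
by case: (leP M x) => My; [case: (leP (- M) M)|case: (leP (- M) x)] => h;
  case: (ler0P x) => ?; rewrite ?ler_norml; lra.
Qed.

(** Continuous functions [g n] approximate [f] in L_1. Clamping them to [-M, M] gives |f - clamp
    g|^q <= (2M)^(q-1) |f - g|, which upgrades this to L_q. *)
Lemma bounded_in_span (f : R -> R) M : measurable_fun setT (f : T -> R) -> 0 < M ->
  (forall x, `|f x| <= M) -> closed_span (Lcl q1 f).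
Proof.
move=> mf M0 fM.
have mI : measurable (`]0, 1[%classic : set T) by exact: measurable_itv.
have Ioo : (mu (`]0%R, 1%R[%classic : set T) < +oo)%E.
  by rewrite lebesgue_measure_itv/= lte_fin ltr01 -EFinD ltry.
have inf : inL q f by apply: (@inL_bounded R q q1 f M).
have intf : mu.-integrable (`]0, 1[%classic : set T) (EFin \o f).
  apply: measurable_bounded_integrable => //; first exact: measurable_funTS.
  exists M; split; first exact: num_real.
  by move=> y My x _ /=; rewrite (le_trans (fM x))// ltW.
have [g [cg ig gf]] := approximation_continuous_integrable mI Ioo intf.
apply: in_closed_span_closed => d d0; have d2 : 0 < d / 2 by rewrite divr_gt0.
have lt2 : d / 2 < d by rewrite ltr_pdivrMr// ltr_pMr// ltrDl.
pose C := (2 * M) `^ (q - 1).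
have C0 : 0 < C by apply: powR_gt0; rewrite mulr_gt0.
have e0 : 0 < (d / 2) `^ q / C by rewrite divr_gt0//; apply: powR_gt0.
have [n gn] : exists n, (\int[mu]_(x in `]0%R, 1%R[) `|(f x - g n x)%:E| <
    ((d / 2) `^ q / C)%:E)%E.
  move/fine_cvgP: gf => [[n0 _ h1] /cvgrPdist_lt/(_ _ e0)[n1 _ h2]].
  exists (maxn n0 n1); have := h1 _ (leq_maxl n0 n1); have := h2 _ (leq_maxr n0 n1).
  move=> /= h3 h4; rewrite -(fineK h4) lte_fin; apply: le_lt_trans h3.
  by rewrite sub0r normrN ler_norm.
have cc : contf (fun x => clamp M (g n x)) by apply: contf_comp; [exact: contf_clamp|exact: cg].
exists (Lcl q1 (fun x => clamp M (g n x))); first exact: contf_in_span.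
apply: (le_lt_trans _ lt2).
have inh := inL_contf q1 cc.
rewrite -LclB//.
have ind := inLB q1 inf inh.
have -> : d / 2 = ((d / 2) `^ q) `^ q^-1.
  by rewrite -powRrM mulfV ?gt_eqF// powRr1// ltW.
apply: (powR_le_root q1) => //; first by rewrite powR_ge0.
rewrite -lee_fin powR_norm_Lcl//.
apply: (@le_trans _ _ (\int[mu]_(x in `]0%R, 1%R[) (C%:E * `|(f x - g n x)%:E|))%E).
  apply: ge0_le_integral => //.
  - apply: measurable_funTS; apply: measurable_normr_powR.
    exact: inL_measurable ind.
  - apply: measurable_funTS; apply/measurable_EFinP.
    apply: measurable_funM => //; apply: measurableT_comp => //.
    by apply: measurable_funB => //; exact: contf_measurable.
  move=> x _; rewrite lee_fin.
  have [->|h0] := eqVneq (f x - clamp M (g n x)) 0.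
    by rewrite normr0 powR0 ?gt_eqF// mulr_ge0// ltW.
  rewrite -[X in _ `^ X](subrK 1) powRD; last by rewrite normr_eq0 h0 implybT.
  rewrite powRr1//; apply: ler_pM => //.
    apply: ge0_ler_powR; rewrite ?nnegrE ?subr_ge0 ?(ltW q1) ?mulr_ge0 ?(ltW M0)//.
    rewrite (le_trans (ler_normB _ _))// mulr_natl mulr2n lerD//.
    exact: normr_clamp (ltW M0).
  exact: normr_sub_clamp (ltW M0) (fM x).
rewrite ge0_integralZl//; [|by apply: measurable_funTS; apply/measurable_EFinP;
  apply: measurableT_comp => //; apply: measurable_funB => //; exact: contf_measurable
  |by rewrite lee_fin ltW].
have -> : (d / 2) `^ q = C * ((d / 2) `^ q / C).
  by rewrite [RHS]mulrC divfK// gt_eqF.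
by rewrite EFinM lee_pmul2l// ?lte_fin// ltW.
Qed.

Lemma Lcl_surj (u : L01 q1) : exists2 f, inL q f & u = Lcl q1 f.
Proof.
exists (Lrepr u : R -> R); first exact: LfunP.
rewrite (Lcl_Sub q1 (LfunP (Lrepr u))) -[LHS]LreprK; congr Lclass.
exact/LfuneqP.
Qed.

(** Unbounded functions are reached by truncation: at each point the clamped [f] is eventually [f],
    and |f|^q dominates the error. *)
Lemma sine_total (u : L01 q1) : closed_span u.
Proof.
have [f inf ->] := Lcl_surj u; have mf := inL_measurable inf.
have mI : measurable (`]0, 1[%classic : set T) by exact: measurable_itv.
have mc n : measurable_fun setT ((fun x => clamp n.+1%:R (f x)) : T -> R).
  by apply: (@measurableT_comp _ _ _ _ _ _ (clamp n.+1%:R)) => //;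
    apply: contf_measurable; exact: contf_clamp.
have inc n : inL q (fun x => clamp n.+1%:R (f x)).
  by apply: (@inL_bounded R q q1 _ n.+1%:R) => // x _; exact: normr_clamp.
have ind n := inLB q1 inf (inc n).
pose I : set T := `]0, 1[%classic.
pose fn n (x : T) := (`|f x - clamp n.+1%:R (f x)| `^ q)%:E.
have mfn n : measurable_fun I (fn n).
  by apply: measurable_funTS; apply: measurable_normr_powR; exact: inL_measurable (ind n).
have cv : {ae mu, forall x, I x -> fn ^~ x @ \oo --> 0%E}.
  apply: aeW => x _; apply: cvg_near_cst; near=> n; rewrite /fn clamp_id.
    by rewrite subrr normr0 powR0// gt_eqF.
  rewrite (@le_trans _ _ n%:R)// ?ler_nat//; near: n; exact: nbhs_infty_ger.
have ig : mu.-integrable I (fun x => (`|f x| `^ q)%:E).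
  apply/integrableP; split; first by apply: measurable_funTS; exact: measurable_normr_powR.
  under eq_integral do rewrite gee0_abs ?lee_fin ?powR_ge0//.
  by rewrite -(powR_norm_Lcl q1)// ltry.
have dom : {ae mu, forall x n, I x -> (`|fn n x| <= (`|f x| `^ q)%:E)%E}.
  apply: aeW => x n _; rewrite gee0_abs ?lee_fin ?powR_ge0//.
  by rewrite ge0_ler_powR ?nnegrE ?(ltW q0)// normr_sub_clamp0.
have [_ _] := dominated_convergence mI mfn (measurable_cst 0%E) cv ig dom.
rewrite integral0 => h.
apply: in_closed_span_closed => d d0; have d2 : 0 < d / 2 by rewrite divr_gt0.
have lt2 : d / 2 < d by rewrite ltr_pdivrMr// ltr_pMr// ltrDl.
have e0 : 0 < (d / 2) `^ q by apply: powR_gt0.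
have [n hn] : exists n, `|Lcl q1 (fun x => f x - clamp n.+1%:R (f x))| `^ q < (d / 2) `^ q.
  move/fine_cvgP: h => [_ /cvgrPdist_lt/(_ _ e0)[n _ hn]].
  exists n; have := hn n (leqnn n).
  rewrite /= sub0r normrN -(powR_norm_Lcl q1 (ind n))/=; apply: le_lt_trans.
  exact: ler_norm.
exists (Lcl q1 (fun x => clamp n.+1%:R (f x))).
  by apply: (@bounded_in_span _ n.+1%:R) => // x; exact: normr_clamp.
rewrite -LclB//; apply: (le_lt_trans _ lt2).
have -> : d / 2 = ((d / 2) `^ q) `^ q^-1.
  by rewrite -powRrM mulfV ?gt_eqF// powRr1// ltW.
by apply: (powR_le_root q1) => //; [exact: powR_ge0|exact: ltW].
Unshelve. all: by end_near. Qed.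

(** All sines have the same norm, so if one vanished, totality would force the class of the constant
    1 to be zero. *)
Lemma sine1_neq0 : sine q1 1 != 0.
Proof.
apply/eqP => s10.
have s0 n : sine q1 n.+1 = 0.
  have := @sine_dilation R q q1 (fun=> 1) 1 n.+1 (ltn0Sn n).
  rewrite !big_ord1 !scale1r muln1 s10 normr0 => /eqP.
  by rewrite normr_eq0 => /eqP.
have c1 : contf (fun _ : R => 1 : R) by exact: contf_cst.
have := powR_norm_contf q1 c1.
have -> : Lcl q1 (fun=> 1) = 0.
  apply/eqP; rewrite -normr_le0; apply/ler_addgt0Pl => d d0; rewrite addr0.
  have [N [a]] := @sine_total (Lcl q1 (fun=> 1)) _ d0.
  by rewrite big1 ?subr0 => [|n _]; [exact: ltW|rewrite s0 scaler0].
rewrite normr0 powR0 ?gt_eqF// normr1 powR1 Rintegral_cst_itv// => /eqP.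
by rewrite eq_sym mulr1 oner_eq0.
Qed.

End sine_density.

Theorem theorem2p6 (R : realType) (q : R) (q1 : 1 < q) :
  schauder_basis (fun n : nat => dilated_triwave q1 n.+1).
Proof.
have [K HK] := sine_grunblum q1.
apply: (@perturbed_basis R (L01 q1) (sine q1) (dilated_triwave q1) (@triwave_coef R) K).
- exact: sine1_neq0.
- exact: sine_dilation.
- exact: triwave_expansion.
- exact: triwave_coef0.
- exact: triwave_coef_le.
- exact: HK.
- exact: sine_total.
Qed.
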